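(* There exists an absolute constant $C>0$, independent of $f$ and of the dimension $d$ (for example, one may take $C=\frac{1}{10^{10}}$), such that for every integer $d\ge 1$ and every $f\in\mathcal{S}(\mathbb{R}^d)\setminus\{0\}$, $$\frac{V(f)}{\|f\|_2^2}\cdot\frac{V(\hat f)}{\|\hat f\|_2^2}\ \geq\ C\,d^2 .$$
   Context: $\mathcal{S}(\mathbb{R}^d)$ is the Schwartz class of complex-valued functions on $\mathbb{R}^d$. The Fourier transform is normalized as $\hat f(\xi)=\int_{\mathbb{R}^d}f(x)e^{-2\pi i x\cdot\xi}\,dx$. $|x|$ is the Euclidean norm, $\|\cdot\|_2$ is the $L^2(\mathbb{R}^d)$ norm, and $V(f):=\int_{\mathbb{R}^d}|x|^2|f(x)|^2\,dx$. *)

(* Defs.v *)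
From HB Require Import structures.
From mathcomp Require Import all_boot all_order all_algebra.
From mathcomp Require Import complex.
From mathcomp Require Import all_classical all_reals all_analysis.

Set Implicit Arguments.
Unset Strict Implicit.
Unset Printing Implicit Defensive.

Import Order.TTheory GRing.Theory Num.Theory.
Import numFieldNormedType.Exports.

Local Open Scope classical_set_scope.
Local Open Scope ring_scope.

(* The sigma-algebra on R^n is generated by the coordinates, as the library
   does for n-tuples. *)
Definition rV_display : measure_display. Proof. exact: default_measure_display. Qed.

Section measurable_rV.
Context {R : realType} (n : nat).

Let coors : 'I_n -> 'rV[R]_n -> R := fun i x => x ord0 i.

Let rV_set0 : g_sigma_preimage coors set0.
Proof. exact: sigma_algebra0. Qed.

Let rV_setC A : g_sigma_preimage coors A -> g_sigma_preimage coors (~` A).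
Proof. exact: sigma_algebraC. Qed.

Let rV_bigcup (F : _^nat) : (forall i, g_sigma_preimage coors (F i)) ->
  g_sigma_preimage coors (\bigcup_i (F i)).
Proof. exact: sigma_algebra_bigcup. Qed.

HB.instance Definition _ := @isMeasurable.Build rV_display
  'rV[R]_n (g_sigma_preimage coors)
  rV_set0 rV_setC rV_bigcup.

Lemma measurable_coord (i : 'I_n) :
  measurable_fun [set: 'rV[R]_n] (fun x : 'rV[R]_n => x ord0 i).
Proof.
move=> _ Y mY; rewrite setTI; apply: sub_sigma_algebra => /=.
rewrite -bigcup_seq/=; exists i => /=; first by rewrite mem_index_enum.
by exists Y => //; rewrite setTI.
Qed.

Lemma measurable_fun_rVP d (T : measurableType d) (f : T -> 'rV[R]_n) :
  measurable_fun [set: T] f <->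
  forall i, measurable_fun [set: T] (fun t => f t ord0 i).
Proof.
split=> [mf i|mf].
  exact: (measurableT_comp (measurable_coord i)).
apply: (@measurability _ _ _ _ setT f
  (\big[setU/set0]_(i < n) preimage_set_system setT (coors i) measurable)) => //.
move=> Z [B]; rewrite -bigcup_seq => -[i _ [A mA <-]] <-.
by rewrite !setTI -comp_preimage -[X in measurable X]setTI; exact: mf.
Qed.

End measurable_rV.

Definition rV_cons {R : realType} {n : nat} (p : R * 'rV[R]_n) : 'rV[R]_n.+1 :=
  row_mx (p.1%:M : 'rV_1) p.2.

Section lebesgue_cons.
Context {R : realType} {n : nat}.

Lemma rV_cons0 (p : R * 'rV[R]_n) : rV_cons p ord0 ord0 = p.1.
Proof.
have -> : ord0 = lshift n ord0 :> 'I_(1 + n) by exact: val_inj.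
by apply: etrans (row_mxEl _ _ _ _) _; rewrite mxE eqxx.
Qed.

Lemma rV_consS (p : R * 'rV[R]_n) (i : 'I_n) :
  rV_cons p ord0 (lift ord0 i) = p.2 ord0 i.
Proof.
have -> : lift ord0 i = rshift 1 i :> 'I_(1 + n) by exact: val_inj.
exact: row_mxEr.
Qed.

Lemma measurable_rV_cons : measurable_fun setT (@rV_cons R n).
Proof.
apply/measurable_fun_rVP => i.
case: (unliftP ord0 i) => [j|] ->.
  under eq_fun do rewrite rV_consS.
  exact: (measurableT_comp (measurable_coord j) measurable_snd).
by under eq_fun do rewrite rV_cons0; exact: measurable_fst.
Qed.

Variable mu : {sigma_finite_measure set 'rV[R]_n -> \bar R}.

Definition lebesgue_cons : set 'rV[R]_n.+1 -> \bar R :=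
  pushforward (@lebesgue_measure R \x mu)%E rV_cons.

Let m0 : lebesgue_cons set0 = 0%E.
Proof. by rewrite /lebesgue_cons /pushforward preimage_set0 measure0. Qed.

Let m_ge0 A : (0 <= lebesgue_cons A)%E.
Proof. by apply: integral_ge0 => x _; exact: measure_ge0. Qed.

Let m_sigma_additive : semi_sigma_additive lebesgue_cons.
Proof.
move=> F mF tF mUF; rewrite /lebesgue_cons /pushforward preimage_bigcup.
apply: measure_sigma_additive.
  by move=> n0; rewrite -[X in measurable X]setTI; exact: measurable_rV_cons.
apply/trivIsetP => /= i j _ _ ij; rewrite -preimage_setI.
by move/trivIsetP : tF => /(_ _ _ _ _ ij) ->//; rewrite preimage_set0.
Qed.

HB.instance Definition _ := isMeasure.Build _ _ _ lebesgue_cons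
  m0 m_ge0 m_sigma_additive.

Lemma lebesgue_cons_sigma_finite : sigma_finite setT lebesgue_cons.
Proof.
have [F UF mF] : sigma_finite setT (@lebesgue_measure R \x mu)%E.
  have /sigma_finiteP[G [TG ndG Goo]] := sigma_finiteT (@lebesgue_measure R).
  have /sigma_finiteP[H [TH ndH Hoo]] := sigma_finiteT mu.
  exists (fun k => G k `*` H k).
    rewrite -setXTT TG TH; apply/seteqP; split => -[x y] /=; last first.
      by move=> [k _ []/= ? ?]; split; exists k.
    move=> [/= [k _ Gkx] [l _ Hly]]; exists (maxn k l) => //; split.
      by move: x Gkx; exact/subsetPset/ndG/leq_maxl.
    by move: y Hly; exact/subsetPset/ndH/leq_maxr.
  move=> k; have [? ?] := Goo k; have [? ?] := Hoo k.
  split; first exact: measurableX.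
  by rewrite product_measure1E// lte_mul_pinfty// ge0_fin_numE.
pose g (x : 'rV[R]_n.+1) : R * 'rV[R]_n :=
  (x ord0 ord0, \row_i x ord0 (lift ord0 i)).
have gK p : g (rV_cons p) = p.
  case: p => a x; congr pair => /=; first exact: rV_cons0.
  by apply/rowP => i; rewrite mxE; exact: (rV_consS (a, x)).
have mg : measurable_fun setT g.
  apply/measurable_fun_pairP; split; first exact: measurable_coord.
  apply/measurable_fun_rVP => i /=.
  by under eq_fun do rewrite mxE; exact: measurable_coord.
exists (fun k => g @^-1` F k) => [|k].
  by rewrite -preimage_bigcup -UF preimage_setT.
split; first by rewrite -[X in measurable X]setTI; apply: mg => //; exact: (mF k).1.
rewrite /lebesgue_cons /pushforward -comp_preimage.
by rewrite (_ : g \o rV_cons = id); [exact: (mF k).2|exact/funext/gK].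
Qed.

HB.instance Definition _ := @Measure_isSigmaFinite.Build _ _ _ lebesgue_cons
  lebesgue_cons_sigma_finite.

End lebesgue_cons.

(* Product Lebesgue measure on R^n, by recursion on n: the unit mass on the
   one-point space R^0, then the image of the product measure on R x R^n under
   the identification with R^(n+1). *)
Fixpoint lebesgue_rV (R : realType) (n : nat) :
    {sigma_finite_measure set 'rV[R]_n -> \bar R} :=
  match n with
  | 0%N => \d_(0 : 'rV[R]_0)
  | m.+1 => lebesgue_cons (lebesgue_rV R m)
  end.

Lemma lebesgue_rV_box (R : realType) (n : nat) (A : 'I_n -> set R) :
  (forall i, measurable (A i)) ->
  lebesgue_rV R n [set x | forall i, A i (x ord0 i)] =
  (\prod_(i < n) lebesgue_measure (A i))%E.
Proof.
elim: n A => [|n IH] A mA.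
  rewrite big_ord0 /= diracE mem_set//=; by case.
have mB : measurable [set x : 'rV[R]_n | forall i, A (lift ord0 i) (x ord0 i)].
  rewrite (_ : mkset _ = \bigcap_(i in [set: 'I_n])
      ((fun x : 'rV[R]_n => x ord0 i) @^-1` A (lift ord0 i))).
    apply: fin_bigcap_measurable => // i _.
    by rewrite -[X in measurable X]setTI; exact: measurable_coord.
  by apply/seteqP; split => [x h i _|x h i]; [exact: h|exact: (h i Logic.I)].
rewrite big_ord_recl -IH//= /lebesgue_cons /pushforward -product_measure1E//.
  congr product_measure1; apply/seteqP; split => -[a x] /=.
    move=> h; split; first by have := h ord0; rewrite rV_cons0.
    by move=> i; have := h (lift ord0 i); rewrite rV_consS.
  move=> [h0 h] i; case: (unliftP ord0 i) => [j|] ->; last by rewrite rV_cons0.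
  by rewrite rV_consS; exact: h.
exact: mA.
Qed.

Section schwartz_space.
Context {R : realType} (d : nat).
Implicit Types (f : 'rV[R]_d -> R[i]) (x xi : 'rV[R]_d).

(* The library norm on 'rV[R]_d is the sup norm. *)
Definition enorm x : R := Num.sqrt (\sum_(i < d) x ord0 i ^+ 2).

Definition dotp x xi : R := \sum_(i < d) x ord0 i * xi ord0 i.

Definition re_part f : 'rV[R]_d -> R := fun x => complex.Re (f x).
Definition im_part f : 'rV[R]_d -> R := fun x => complex.Im (f x).

(* R[i] is a normed space over itself but not over R in the library, so
   real derivatives of complex-valued functions are taken componentwise. *)
Definition partial (i : 'I_d) f : 'rV[R]_d -> R[i] := fun x =>
  ('D_(delta_mx ord0 i) (re_part f) x +i* 'D_(delta_mx ord0 i) (im_part f) x)%C.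

Definition partials (s : seq 'I_d) f : 'rV[R]_d -> R[i] := foldr partial f s.

(* Derivatives are total operators, so the existence of every iterated partial
   derivative is part of the definition. *)
Definition smooth f : Prop := forall s : seq 'I_d,
  [/\ continuous (re_part (partials s f)),
      continuous (im_part (partials s f)) &
      forall (i : 'I_d) x,
        derivable (re_part (partials s f)) x (delta_mx ord0 i) /\
        derivable (im_part (partials s f)) x (delta_mx ord0 i)].

Definition schwartz f : Prop :=
  smooth f /\
  forall (a : 'I_d -> nat) (s : seq 'I_d), exists M : R, forall x,
    `|\prod_(i < d) x ord0 i ^+ a i| * Normc.normc (partials s f x) <= M.

Definition Cintegral f : R[i] :=
  (\int[lebesgue_rV R d]_x re_part f x +i* \int[lebesgue_rV R d]_x im_part f x)%C.

Definition cis (t : R) : R[i] := (cos t +i* sin t)%C.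

Definition fourier f : 'rV[R]_d -> R[i] := fun xi =>
  Cintegral (fun x => f x * cis (- (2 * pi * dotp x xi))).

Definition L2norm f : R :=
  fine (Lnorm (lebesgue_rV R d) 2%:E (fun x => (Normc.normc (f x))%:E)).

Definition moment2 f : R :=
  \int[lebesgue_rV R d]_x (enorm x ^+ 2 * Normc.normc (f x) ^+ 2).

End schwartz_space.

(* Main.v *)
(* Writing f = u + iv, it is enough to know the transforms of the real functions
   u, v.  For real u let P_u be the squared modulus of its transform.  Plancherel's
   identity [int P_u = int u^2] is obtained by inserting the weight
   [exp(- e |xi|_1)]: its cosine transform is a product of one-dimensional Poisson
   kernels, so the weighted integral equals
   [int int u(x) u(x - e z) poisson(z)], which tends to [int u^2] as e tends to 0,
   while the left-hand side increases to [int P_u].  Applied to the partial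
   derivatives of u it gives [4 pi^2 int xi_i^2 P_u = int (D_i u)^2].  Finally
   [int u^2 = - 2 int x_i u D_i u] and the inequality
   [2 |ab| <= l a^2 + b^2 / l], summed over i, bound [d * mass] by
   [l * second_moment + energy / l] for every l > 0; optimising in l yields the
   sharp constant 1 / (16 pi^2).  Integration by parts over R^d follows from
   translation invariance and dominated convergence of difference quotients. *)

Require Import Defs.
From mathcomp Require Import all_boot all_order all_algebra.
From mathcomp Require Import complex.
From mathcomp Require Import all_classical all_reals all_analysis.
From mathcomp Require Import measurable_realfun ring lra.
Set Implicit Arguments.
Unset Strict Implicit.
Unset Printing Implicit Defensive.
Import Order.TTheory GRing.Theory Num.Theory.
Import numFieldNormedType.Exports.
Local Open Scope classical_set_scope.
Local Open Scope ring_scope.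

(** * Affine changes of variables *)

(** The obstacle is that [powerT u] is bounded but not known in advance to be integrable, so the
    double integral behind Plancherel's identity need not converge absolutely. The exponential
    weight makes every interchange of integrals legitimate, and monotone convergence removes it
    again without any integrability assumption on [powerT u]. On the space side all dependence on
    the scale is moved inside [u], so a single majorant serves every scale. For integration by parts
    the majorant is [lorentz], the product of the functions 1 / (1 + x_i^2): it is integrable,
    changes by at most a factor 3 under a shift of length at most 1 along one axis, and dominates
    Schwartz functions by way of finitely many monomials. The growth d^2 arises because every
    coordinate yields a bound on the whole mass, while it uses only its own share of the second
    moment and of the energy. *)

Section integral_cons.
Context {R : realType} {n : nat}.
Local Open Scope ereal_scope.
Implicit Type f : 'rV[R]_n.+1 -> \bar R.

Let phi : measurableTypeR R * 'rV[R]_n -> 'rV[R]_n.+1 := rV_cons.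
Let mphi : measurable_fun setT phi.
Proof. exact: measurable_rV_cons. Qed.

(** Tonelli, read through the pushforward that defines [lebesgue_rV]. Peeling off the first
    coordinate in this way drives the inductions on the dimension. *)
Lemma ge0_integral_rV_cons f : measurable_fun setT f -> (forall x, 0 <= f x) ->
  \int[lebesgue_rV R n.+1]_x f x =
  \int[lebesgue_measure]_a \int[lebesgue_rV R n]_x f (rV_cons (a, x)).
Proof.
move=> mf f0.
have := ge0_integral_pushforward mphi (@lebesgue_measure R \x lebesgue_rV R n)
  measurableT mf (fun x _ => f0 x).
rewrite preimage_setT => ->; rewrite fubini_tonelli1//.
  exact: (measurableT_comp mf mphi).
by move=> x; exact: f0.
Qed.

Lemma integrable_rV_cons f : 
  (lebesgue_rV R n.+1).-integrable setT f ->
  (lebesgue_measure \x lebesgue_rV R n).-integrable setT (f \o phi).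
Proof.
move=> /integrableP[mf foo]; apply/integrableP; split.
  exact: (measurableT_comp mf mphi).
have := @ge0_integral_pushforward _ _ _ _ _ _ mphi
  (@lebesgue_measure R \x lebesgue_rV R n) setT (fun x => `|f x|) measurableT.
rewrite preimage_setT => <-//.
exact: measurableT_comp.
Qed.

Lemma integral_rV_cons f : 
  (lebesgue_rV R n.+1).-integrable setT f ->
  \int[lebesgue_rV R n.+1]_x f x =
  \int[lebesgue_measure]_a \int[lebesgue_rV R n]_x f (rV_cons (a, x)).
Proof.
move=> fi; have fci := integrable_rV_cons fi.
have mf := measurable_int _ fi.
have := @integral_pushforward _ _ _ _ _ _ mphi
  (@lebesgue_measure R \x lebesgue_rV R n) setT f mf.
rewrite preimage_setT => /(_ fci measurableT) ->.
by rewrite -integral12_prod_meas1.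
Qed.

End integral_cons.

Section affine.
Context {R : realType}.
Local Open Scope ereal_scope.

Definition affine (s c : R) : measurableTypeR R -> measurableTypeR R :=
  fun x => (s * x + c)%R.

Lemma measurable_affine s c : measurable_fun setT (affine s c).
Proof. by apply: measurable_funD => //; exact: measurable_funM. Qed.

(* The measure structure of a pushforward depends on a measurability proof, so it
   is given explicitly. *)
Definition affine_measure (s c : R) :
    {measure set (measurableTypeR R) -> \bar R} :=
  mscale (NngNum (normr_ge0 s))
    (measure_function_pushforward__canonical__measure_function_Measure
       lebesgue_measure (measurable_affine s c)).

(** Lebesgue measure is determined by half-open intervals. Pushing it forward along [affine s c]
    divides lengths by [|s|], which the scaling in [affine_measure] restores. *)
Lemma lebesgue_measure_affine (s c : R) (A : set R) : (s != 0)%R ->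
  measurable A -> affine_measure s c A = lebesgue_measure A.
Proof.
move=> s0 mA.
apply/esym/lebesgue_measure_unique => //= _ [[a b]] _ <-.
rewrite /= /mscale/= [X in _ = _ * X]/pushforward.
have [s_gt0|s_le0] := ltP 0%R s.
  have E : affine s c @^-1` [set` `]a, b]] =
      `]((a - c) / s)%R, ((b - c) / s)%R]%classic.
    apply/seteqP; split => x /=; rewrite /affine !in_itv/= ltr_pdivrMr// ler_pdivlMr//;
      by move=> /andP[? ?]; apply/andP; split; lra.
  rewrite E !lebesgue_measure_itv/= !lte_fin ltr_pM2r ?invr_gt0// ltrD2r.
  case: ifPn => ab; last by rewrite mule0.
  by rewrite gtr0_norm// -!EFinB -EFinM; congr EFin; field.
have s_lt0 : (s < 0)%R by rewrite lt_neqAle s0.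
(* A negative slope exchanges the end points, so the preimage is closed on the left; its length is
   unaffected. *)
have E : affine s c @^-1` [set` `]a, b]] =
    `[((b - c) / s)%R, ((a - c) / s)%R[%classic.
  apply/seteqP; split => x /=; rewrite /affine !in_itv/= ltr_ndivlMr// ler_ndivrMr//;
      by move=> /andP[? ?]; apply/andP; split; lra.
rewrite E !lebesgue_measure_itv/= !lte_fin ltr_nM2r ?invr_lt0// ltrD2r.
case: ifPn => ab; last by rewrite mule0.
by rewrite ltr0_norm// -!EFinB -EFinM; congr EFin; field.
Qed.

Lemma ge0_integral_affine1 (s c : R) (f : R -> \bar R) : (s != 0)%R ->
  measurable_fun setT f -> (forall x, 0 <= f x) ->
  `|s|%:E * \int[lebesgue_measure]_x f (s * x + c)%R =
  \int[lebesgue_measure]_x f x.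
Proof.
move=> s0 mf f0.
transitivity (\int[affine_measure s c]_x f x); last first.
  by apply: eq_measure_integral => A mA _; exact: lebesgue_measure_affine.
rewrite /affine_measure/= ge0_integral_mscale//=.
by rewrite (ge0_integral_pushforward (measurable_affine s c))//= preimage_setT.
Qed.

Lemma measurable_affine_rV n (s : R) (c : 'rV[R]_n) :
  measurable_fun setT (fun x : 'rV[R]_n => s *: x + c)%R.
Proof.
apply/measurable_fun_rVP => i; under eq_fun do rewrite !mxE.
by apply: measurable_funD => //; apply: measurable_funM => //; exact: measurable_coord.
Qed.

Lemma rV_cons_affine n (s a : R) (x : 'rV[R]_n) (c : 'rV[R]_n.+1) :
  (s *: rV_cons (a, x) + c =
   rV_cons (s * a + c ord0 ord0, s *: x + \row_i c ord0 (lift ord0 i)))%R.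
Proof.
apply/rowP => i; rewrite mxE [X in (X + _)%R]mxE; have [j|] := unliftP ord0 i => ->.
  by rewrite !rV_consS/= !mxE.
by rewrite !rV_cons0.
Qed.

Lemma ge0_integral_affine n (s : R) (c : 'rV[R]_n) (f : 'rV[R]_n -> \bar R) :
  (s != 0)%R -> measurable_fun setT f -> (forall x, 0 <= f x) ->
  (`|s| ^+ n)%:E * \int[lebesgue_rV R n]_x f (s *: x + c)%R =
  \int[lebesgue_rV R n]_x f x.
Proof.
move=> s0; elim: n => [|n IH] in c f *=> mf f0.
  rewrite expr0 mul1e; apply: eq_integral => x _.
  by congr f; rewrite [LHS]thinmx0 [RHS]thinmx0.
have mfa : measurable_fun setT (fun x : 'rV[R]_n.+1 => f (s *: x + c)%R).
  exact: (measurableT_comp mf (measurable_affine_rV s c)).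
rewrite !ge0_integral_rV_cons//.
under eq_integral => a _ do under eq_integral => x _ do rewrite rV_cons_affine.
pose F b := \int[lebesgue_rV R n]_x f (rV_cons (b, x)).
pose c' : 'rV[R]_n := (\row_i c ord0 (lift ord0 i))%R.
have mF : measurable_fun setT F.
  apply: (measurable_fun_fubini_tonelli_F (f \o rV_cons)) => [|x].
    exact: (measurableT_comp mf (@measurable_rV_cons R n)).
  exact: f0.
rewrite -[RHS]/(\int[lebesgue_measure]_b F b).
(* The first coordinate supplies one factor [|s|]; the induction hypothesis on the fibres supplies
   the remaining [|s| ^+ n]. *)
rewrite -(@ge0_integral_affine1 s (c ord0 ord0) F)//; last first.
  by move=> b; exact: integral_ge0.
rewrite exprS EFinM -muleA; congr (_ * _).
rewrite -ge0_integralZl//; last 2 first.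
- have mG : measurable_fun setT (fun p : measurableTypeR R * 'rV[R]_n =>
        f (rV_cons (affine s (c ord0 ord0) p.1, s *: p.2 + c')%R)).
    apply: (measurableT_comp mf); apply: (measurableT_comp (@measurable_rV_cons R n)).
    apply/measurable_fun_pairP; split.
      exact: (measurableT_comp (measurable_affine _ _) measurable_fst).
    exact: (measurableT_comp (measurable_affine_rV _ _) measurable_snd).
  exact: (measurable_fun_fubini_tonelli_F _ mG (fun p => f0 _)).
- by move=> x _; exact: integral_ge0.
apply: eq_integral => a _.
rewrite (IH c' (fun x => f (rV_cons (s * a + c ord0 ord0, x)%R)))//.
apply: (measurableT_comp mf); apply: (measurableT_comp (@measurable_rV_cons R n)).
exact: measurable_pair1.
Qed.

Lemma integrable_affine n (s : R) (c : 'rV[R]_n) (f : 'rV[R]_n -> \bar R) :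
  (s != 0)%R -> (lebesgue_rV R n).-integrable setT f ->
  (lebesgue_rV R n).-integrable setT (fun x : 'rV[R]_n => f (s *: x + c)%R).
Proof.
move=> s0 /integrableP[mf foo]; apply/integrableP; split.
  exact: (measurableT_comp mf (measurable_affine_rV s c)).
have mf' : measurable_fun setT (fun x => `|f x|) by exact: measurableT_comp.
have := @ge0_integral_affine n s c (fun x => `|f x|) s0 mf' (fun x => abse_ge0 _).
move=> /(congr1 (fun x => (`|s| ^- n)%:E * x)).
rewrite muleA -EFinM mulVf ?mul1e; last by rewrite expf_neq0 ?normr_eq0.
by move=> ->; rewrite lte_mul_pinfty// lee_fin invr_ge0 exprn_ge0.
Qed.

Lemma integral_affine n (s : R) (c : 'rV[R]_n) (f : 'rV[R]_n -> \bar R) :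
  (s != 0)%R -> (lebesgue_rV R n).-integrable setT f ->
  (`|s| ^+ n)%:E * \int[lebesgue_rV R n]_x f (s *: x + c)%R =
  \int[lebesgue_rV R n]_x f x.
Proof.
move=> s0 fi; have fai := integrable_affine c s0 fi.
have mf := measurable_int _ fi.
rewrite [X in _ * X]integralE [RHS]integralE muleBr//; last exact: integrable_add_def.
rewrite -[X in integral _ _ X^\+]/(f \o (fun x => s *: x + c)%R) funepos_comp.
rewrite -[X in integral _ _ X^\-]/(f \o (fun x => s *: x + c)%R) funeneg_comp.
congr (_ - _).
  exact: (ge0_integral_affine c s0 (measurable_funepos mf) (funepos_ge0 f)).
exact: (ge0_integral_affine c s0 (measurable_funeneg mf) (funeneg_ge0 f)).
Qed.
End affine.

(** * The Poisson kernel *)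

Section one_dimensional_integrals.
Context {R : realType}.

Lemma integral_oneDsqrV :
  (\int[lebesgue_measure]_x ((@oneDsqr R x)^-1)%:E = pi%:E)%E.
Proof.
rewrite ge0_symfun_integralT//=.
- rewrite (_ : [set x | _] = `[0, +oo[%classic); last first.
    by apply/seteqP; split => x/=; rewrite in_itv/= andbT.
  by rewrite integral0y_oneDsqr -EFinM mulrCA divff// mulr1.
- exact: continuous_oneDsqrV.
- by move=> x/=; rewrite /oneDsqr sqrrN.
Qed.

Definition laplace (a : R) : R := expR (- `|a|).

Lemma continuous_laplace : continuous laplace.
Proof.
move=> x; apply: continuous_comp; last exact: continuous_expR.
by apply: cvgN; exact: norm_continuous.
Qed.

(** Adding 1 to the cosine makes the integrand nonnegative, so that the fundamental theorem of
    calculus on a half-line applies without prior integrability. The extra term is subtracted in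
    [integral_laplace_cos]. *)
Lemma integral_laplace_1Dcos (z : R) :
  (\int[lebesgue_measure]_a (laplace a * (1 + cos (z * a)))%:E =
   (2 + 2 / oneDsqr z)%:E)%E.
Proof.
have cosz (b : R) : continuous (fun a : R => cos (z * a)).
  move=> a; apply: continuous_comp; last exact: continuous_cos.
  by apply: cvgM; [exact: cvg_cst|exact: cvg_id].
rewrite ge0_symfun_integralT//=; last 3 first.
- by move=> a; rewrite mulr_ge0// ?expR_ge0// -lerBlDl sub0r cos_geN1.
- move=> a; apply: cvgM; first exact: continuous_laplace.
  by apply: cvgD; [exact: cvg_cst|exact: cosz].
- by move=> a /=; rewrite /laplace normrN mulrN cosN.
rewrite (_ : [set x | _] = `[0, +oo[%classic); last first.
  by apply/seteqP; split => x/=; rewrite in_itv/= andbT.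
(* An explicit antiderivative of the integrand on the half-line, obtained by integrating exp(-a)
   cos(z a) by parts twice. *)
pose F (a : R) := expR (- a) * (- 1 + (z * sin (z * a) - cos (z * a)) / oneDsqr z).
pose f (a : R) := expR (- a) * (1 + cos (z * a)).
have z0 : oneDsqr z != 0 by rewrite gt_eqF// (lt_le_trans _ (oneDsqr_ge1 z)).
have zV : 0 <= (oneDsqr z)^-1 by rewrite invr_ge0 (le_trans ler01 (oneDsqr_ge1 z)).
transitivity (2%:E * \int[lebesgue_measure]_(x in `[0%R, +oo[) (f x)%:E)%E.
  congr (_ * _)%E; apply: eq_integral => x; rewrite inE/= in_itv/= andbT => x0.
  by rewrite /laplace ger0_norm.
have dF (x : R) : is_derive x 1 F (f x).
  rewrite /F /f.
  apply: is_derive_eq.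
  rewrite /GRing.scale/= /oneDsqr; field.
  exact: z0.
rewrite (@ge0_continuous_FTC2y _ f F 0 0); last 6 first.
- by move=> x _; rewrite mulr_ge0// ?expR_ge0// -lerBlDl sub0r cos_geN1.
- apply: continuous_subspaceT => x; apply: cvgM.
    apply: continuous_comp; last exact: continuous_expR.
    exact: continuousN.
  by apply: cvgD; [exact: cvg_cst|exact: cosz].
(* Bounding sine and cosine by 1 gives |F x| <= C exp(-x), which squeezes [F] to 0 at infinity. *)
- pose C := 1 + (`|z| + 1) / oneDsqr z.
  refine (squeeze_cvgr (f := fun x => - (C * expR (- x))) (h := fun x => C * expR (- x)) _ _ _).

  + apply: nearW => x; rewrite -ler_norml normrM ger0_norm ?expR_ge0// mulrC ler_wpM2r ?expR_ge0//.
    rewrite (le_trans (ler_normD _ _))// normrN normr1 lerD2l normrM.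
    rewrite (ger0_norm zV) ler_wpM2r//.
    rewrite (le_trans (ler_normB _ _))// lerD//; last first.
      by rewrite ler_norml cos_geN1 cos_le1.
    by rewrite normrM ler_piMr// ler_norml sin_geN1 sin_le1.
  + by rewrite -oppr0 -(mulr0 C); apply: cvgN; apply: cvgM; [exact: cvg_cst|exact: cvgr_expR].
  + by rewrite -(mulr0 C); apply: cvgM; [exact: cvg_cst|exact: cvgr_expR].
- by move=> x _; exact: ex_derive.
- apply: cvg_at_right_filter.
  by apply: differentiable_continuous; apply/derivable1_diffP; exact: ex_derive.
- by move=> x _; rewrite derive1E; exact: derive_val.
rewrite /F mulr0 sin0 cos0 oppr0 expR0 -EFinB -EFinM; congr EFin; field.
by [].
Qed.

End one_dimensional_integrals.

(** * The exponential weight in n variables and its cosine transform *)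

Section products.
Context {R : realType}.
Local Notation mu := (@lebesgue_measure R).

Lemma measurable_laplace : measurable_fun setT (@laplace R).
Proof. by apply: continuous_measurable_fun; exact: continuous_laplace. Qed.

Lemma integral_laplace : (\int[mu]_a (laplace a)%:E = 2%:E)%E.
Proof.
have := @integral_laplace_1Dcos R 0.
under eq_integral => a _ do rewrite mul0r cos0 EFinM.
rewrite ge0_integralZr//; last 2 first.
- by apply/measurable_EFinP; exact: measurable_laplace.
- by move=> x _; rewrite lee_fin expR_ge0.
rewrite /oneDsqr expr0n/= addr0 divr1 => /(congr1 (fun x => x * 2^-1%:E)%E).
rewrite -muleA -!EFinM divff// mule1 => ->.
by congr EFin; field.
Qed.

Lemma integrable_laplace : mu.-integrable setT (EFin \o @laplace R).
Proof.
apply/integrableP; split; first by apply/measurable_EFinP; exact: measurable_laplace.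
under eq_integral => a _ do rewrite /= ger0_norm ?expR_ge0//.
by rewrite integral_laplace ltry.
Qed.

Lemma le_integrable_EFin d (T : measurableType d) (m : {measure set T -> \bar R})
    (f g : T -> R) :
  measurable_fun setT f -> (forall x, `|f x| <= g x) ->
  m.-integrable setT (EFin \o g) -> m.-integrable setT (EFin \o f).
Proof.
move=> mf fg; apply: le_integrable => //; first exact/measurable_EFinP.
by move=> x _; rewrite /= lee_fin (le_trans (fg x))// ler_norm.
Qed.

Lemma measurable_phase (h : R -> R) (z phi : R) : continuous h ->
  measurable_fun setT (fun a => laplace a * h (z * a + phi)).
Proof.
move=> ch; apply: measurable_funM; first exact: measurable_laplace.
apply: continuous_measurable_fun => a.
apply: continuous_comp; last exact: ch.
apply: cvgD; last exact: cvg_cst.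
by apply: cvgM; [exact: cvg_cst|exact: cvg_id].
Qed.

Lemma integrable_laplace_phase (h : R -> R) (z phi : R) :
  continuous h -> (forall x, `|h x| <= 1) ->
  mu.-integrable setT (fun a => (laplace a * h (z * a + phi))%:E).
Proof.
move=> ch h1; apply: le_integrable_EFin integrable_laplace.
  exact: measurable_phase.
by move=> x; rewrite normrM ger0_norm ?expR_ge0// ler_piMr// expR_ge0.
Qed.

Lemma cos_norm_le1 (x : R) : `|cos x| <= 1.
Proof. by rewrite ler_norml cos_geN1 cos_le1. Qed.

Lemma sin_norm_le1 (x : R) : `|sin x| <= 1.
Proof. by rewrite ler_norml sin_geN1 sin_le1. Qed.

(** Reflection turns the positive part into the negative part, so both have the same integral;
    integrability makes it finite and the difference zero. *)
Lemma integral_odd (f : R -> \bar R) : mu.-integrable setT f ->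
  (forall x : R, f (- x)%R = - f x)%E -> (\int[mu]_x f x = 0)%E.
Proof.
move=> fi fodd; have mf := measurable_int _ fi.
rewrite integralE [X in (_ - X)%E](_ : _ = \int[mu]_x f^\+ x)%E.
  by rewrite subee// integrable_pos_fin_num.
have n1 : (-1 : R) != 0 by rewrite oppr_eq0 oner_neq0.
rewrite -[RHS](@ge0_integral_affine1 _ (-1) 0 (f^\+)%E n1 (measurable_funepos mf) (funepos_ge0 f)).
rewrite normrN normr1 mul1e; apply: eq_integral => x _.
rewrite mulN1r addr0 -[RHS]/((f^\+ \o -%R) x)%E -funepos_comp -funeposN.
by congr (funepos _ x); apply/funext => y /=.
Qed.

(** The addition formula leaves only the cosine term, since the sine term is odd. The phase [phi] is
    carried along for the n-dimensional induction. *)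
Lemma integral_laplace_cos (z phi : R) :
  (\int[mu]_a (laplace a * cos (z * a + phi))%:E =
   (cos phi * (2 / oneDsqr z))%:E)%E.
Proof.
have ic := @integrable_laplace_phase _ z 0 (@continuous_cos R) cos_norm_le1.
have is' := @integrable_laplace_phase _ z 0 (@continuous_sin R) sin_norm_le1.
have Ic : (\int[mu]_a (laplace a * cos (z * a + 0))%:E = (2 / oneDsqr z)%:E)%E.
  have := integral_laplace_1Dcos z.
  under eq_integral => a _ do rewrite mulrDr mulr1 -{1}(addr0 (z * a)) EFinD.
  rewrite integralD//; last exact: integrable_laplace.
  rewrite integral_laplace EFinD.
  rewrite -(fineK (integrable_fin_num measurableT ic)) -!EFinD => -[] /addrI ->.
  by [].
have Is : (\int[mu]_a (laplace a * sin (z * a + 0))%:E = 0)%E.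
  apply: integral_odd => // x; rewrite -EFinN; congr EFin.
  by rewrite /laplace normrN !addr0 mulrN sinN mulrN.
transitivity (\int[mu]_a ((cos phi)%:E * (laplace a * cos (z * a + 0))%:E +
    (- sin phi)%:E * (laplace a * sin (z * a + 0))%:E))%E.
  apply: eq_integral => a _; rewrite -!EFinM -EFinD; congr EFin.
  by rewrite !addr0 cosD; ring.
rewrite integralD//; [|exact: integrableZl..].
by rewrite !integralZl// Ic Is mule0 adde0 -EFinM.
Qed.

Definition prodf n (g : R -> R) (x : 'rV[R]_n) : R := \prod_(i < n) g (x ord0 i).

Lemma prodf_cons n (g : R -> R) a (x : 'rV[R]_n) :
  prodf g (rV_cons (a, x)) = g a * prodf g x.
Proof.
rewrite /prodf big_ord_recl rV_cons0; congr (_ * _).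
by apply: eq_bigr => i _; rewrite rV_consS.
Qed.

Lemma prodf_ge0 n (g : R -> R) (x : 'rV[R]_n) : (forall t, 0 <= g t) -> 0 <= prodf g x.
Proof. by move=> g0; exact: prodr_ge0. Qed.

Lemma measurable_prodf n (g : R -> R) : measurable_fun setT g ->
  measurable_fun setT (@prodf n g).
Proof.
move=> mg; apply: measurable_prod => i _.
exact: (measurableT_comp mg (measurable_coord i)).
Qed.

Lemma dotp_cons n (z : 'rV[R]_n.+1) a (x : 'rV[R]_n) :
  dotp z (rV_cons (a, x)) =
  z ord0 ord0 * a + dotp (\row_i z ord0 (lift ord0 i)) x.
Proof.
rewrite /dotp big_ord_recl rV_cons0; congr (_ + _).
by apply: eq_bigr => i _; rewrite rV_consS mxE.
Qed.

Lemma measurable_dotp n (z : 'rV[R]_n) : measurable_fun setT (dotp z).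
Proof.
apply: measurable_sum => i; apply: measurable_funM => //.
exact: measurable_coord.
Qed.

Lemma integral_prodf n (g : R -> R) (G : R) : measurable_fun setT g ->
  (forall t, 0 <= g t) -> (\int[mu]_t (g t)%:E = G%:E)%E ->
  (\int[lebesgue_rV R n]_x (prodf g x)%:E = (G ^+ n)%:E)%E.
Proof.
move=> mg g0 gG.
have G0 : 0 <= G.
  by rewrite -lee_fin -gG; apply: integral_ge0 => x _; rewrite lee_fin.
elim: n => [|n IH].
  rewrite expr0 /= integral_dirac//; first by rewrite diracE in_setT mul1e /prodf big_ord0.
  by apply/measurable_EFinP; exact: measurable_prodf.
rewrite ge0_integral_rV_cons//; last 2 first.
- by apply/measurable_EFinP; exact: measurable_prodf.
- by move=> x; rewrite lee_fin prodf_ge0.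
under eq_integral => a _.
  under eq_integral => x _ do rewrite prodf_cons EFinM.
  rewrite ge0_integralZl//; last 3 first.
  - by apply/measurable_EFinP; exact: measurable_prodf.
  - by move=> x _; rewrite lee_fin prodf_ge0.
  - by rewrite lee_fin.
  rewrite IH.
  over.
rewrite ge0_integralZr//; last 3 first.
- by apply/measurable_EFinP; exact: mg.
- by move=> x _; rewrite lee_fin.
- by rewrite lee_fin exprn_ge0.
by rewrite gG -EFinM exprS.
Qed.

Lemma integrable_prodf n (g : R -> R) (G : R) : measurable_fun setT g ->
  (forall t, 0 <= g t) -> (\int[mu]_t (g t)%:E = G%:E)%E ->
  (lebesgue_rV R n).-integrable setT (EFin \o prodf g).
Proof.
move=> mg g0 gG; apply/integrableP; split.
  by apply/measurable_EFinP; exact: measurable_prodf.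
under eq_integral => x _ do rewrite /= ger0_norm ?prodf_ge0//.
by rewrite (integral_prodf _ mg g0 gG) ltry.
Qed.

Lemma integrable_prodf_laplace n :
  (lebesgue_rV R n).-integrable setT (EFin \o prodf (@laplace R)).
Proof.
apply: integrable_prodf measurable_laplace _ integral_laplace.
by move=> t; exact: expR_ge0.
Qed.

Lemma integrable_prodf_laplace_cos n (z : 'rV[R]_n) (phi : R) :
  (lebesgue_rV R n).-integrable setT
    (fun x => (prodf (@laplace R) x * cos (dotp z x + phi))%:E).
Proof.
apply: le_integrable_EFin (integrable_prodf_laplace n).
  apply: measurable_funM; first by apply: measurable_prodf; exact: measurable_laplace.
  apply: measurableT_comp; first by apply: continuous_measurable_fun; exact: continuous_cos.
  by apply: measurable_funD => //; exact: measurable_dotp.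
have p0 (x : 'rV[R]_n) : 0 <= prodf (@laplace R) x.
  by apply: prodf_ge0 => t; exact: expR_ge0.
by move=> x; rewrite normrM ger0_norm// ler_piMr// cos_norm_le1.
Qed.

(** The induction needs all phases: once the first coordinate [a] is fixed, z_0 a + phi is the phase
    of the remaining integral, and the induction hypothesis returns its cosine as a one-dimensional
    integrand. *)
Lemma integral_prodf_laplace_cos n (z : 'rV[R]_n) (phi : R) :
  (\int[lebesgue_rV R n]_x (prodf (@laplace R) x * cos (dotp z x + phi))%:E =
   (cos phi * prodf (fun t => 2 / oneDsqr t) z)%:E)%E.
Proof.
elim: n => [|n IH] in z phi *.
  rewrite /= integral_dirac//; last first.
    exact: (measurable_int _ (@integrable_prodf_laplace_cos 0 z phi)).
  rewrite diracE in_setT mul1e /prodf /dotp !big_ord0 add0r.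
  by rewrite mul1r mulr1.
rewrite integral_rV_cons//; last exact: integrable_prodf_laplace_cos.
under eq_integral => a _.
  under eq_integral => x _ do rewrite prodf_cons dotp_cons addrAC -mulrA EFinM addrC.
  rewrite integralZl//; last exact: integrable_prodf_laplace_cos.
  rewrite IH -EFinM mulrA EFinM.
  over.
rewrite integralZr//; last first.
  exact: (@integrable_laplace_phase _ _ _ (@continuous_cos R) cos_norm_le1).
rewrite integral_laplace_cos -EFinM /prodf [in RHS]big_ord_recl -mulrA.
by congr (_ * (_ * _))%:E; apply: eq_bigr => i _; rewrite mxE.
Qed.

End products.

(** * Continuous functions on R^n *)

Section continuous_rV.
Context {R : realType} {n : nat}.
Implicit Types (x q : 'rV[R]_n) (r : R).

Definition cube q r : set 'rV[R]_n :=
  [set x | forall i, `]q ord0 i - r, q ord0 i + r[%classic (x ord0 i)].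

Lemma cubeE q r x : cube q r x <-> forall i, `|x ord0 i - q ord0 i| < r.
Proof.
split=> h i; have := h i; rewrite /= in_itv/= ltr_norml => /andP[? ?];
  by apply/andP; split; lra.
Qed.

Lemma measurable_cube q r : measurable (cube q r).
Proof.
rewrite (_ : cube q r = \bigcap_(i in [set: 'I_n])
    ((fun x : 'rV[R]_n => x ord0 i) @^-1` `]q ord0 i - r, q ord0 i + r[)).
  apply: fin_bigcap_measurable => // i _.
  by rewrite -[X in measurable X]setTI; exact: measurable_coord.
by apply/seteqP; split => [x h i _|x h i]; [exact: h|exact: (h i Logic.I)].
Qed.

Lemma cube_nbhs x (A : set 'rV[R]_n) : nbhs x A ->
  exists2 r, 0 < r & cube x r `<=` A.
Proof.
move=> /nbhs_ballP[e /= e0 xeA]; exists e => // y /cubeE xy.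
apply: xeA; split => // i j; rewrite (ord1 i) -ball_normE /= distrC.
exact: xy.
Qed.

(** The sigma-algebra is generated by the coordinates, not by the topology. The two meet because an
    open set is the countable union of the cubes inside it with rational centre and radius 1 / (k +
    1); [unpickle] enumerates these cubes. *)
Lemma open_measurable_rV (A : set 'rV[R]_n) : open A -> measurable A.
Proof.
rewrite openE => oA.
pose C (p : 'rV[rat]_n * nat) : set 'rV[R]_n :=
  cube (map_mx ratr p.1) (p.2.+1%:R^-1).
pose F (k : nat) : set 'rV[R]_n :=
  if unpickle k is Some p then if pselect (C p `<=` A) then C p else set0 else set0.
rewrite (_ : A = \bigcup_k F k).
  apply: bigcupT_measurable => k; rewrite /F; case: unpickle => // p.
  by case: pselect => [a|a]; [exact: measurable_cube|exact: measurable0].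
apply/seteqP; split => [x Ax|x [k _]]; last first.
  by rewrite /F; case: unpickle => // p; case: pselect => // CpA; exact: CpA.
have [e e0 xeA] := cube_nbhs (oA _ Ax).
(* Half of [e], because a point of the rational cube is within one radius of the centre, which is
   itself within one radius of [x]. *)
have [k ke] : exists k : nat, k.+1%:R^-1 < e / 2.
  exists (Num.truncn (e / 2)^-1); rewrite invf_plt ?posrE ?divr_gt0//.
  exact: truncnS_gt.
have k0 : 0 < k.+1%:R^-1 :> R by rewrite invr_gt0.
have [s [sE s0 se]] : exists s : R, [/\ s = k.+1%:R^-1, 0 < s & s < e / 2] by exists k.+1%:R^-1.
have /choice[q qx] : forall i, exists q : rat, `|x ord0 i - ratr q| < s.
  move=> i; have [|q] := @rat_in_itvoo R (x ord0 i - s) (x ord0 i + s).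
    by lra.
  by rewrite in_itv/= => /andP[h1 h2]; exists q; rewrite ltr_norml; apply/andP; split; lra.
pose p := (\row_i q i, k); exists (pickle p) => //.
rewrite /F pickleK; case: pselect => [pA|pNA]; last first.
  case: pNA; apply: subset_trans xeA => y /cubeE /= yq; rewrite -sE in yq; apply/cubeE => i.
  have := yq i; rewrite !mxE => yqi.
  rewrite (_ : y _ _ - _ = (y ord0 i - ratr (q i)) - (x ord0 i - ratr (q i))); last by ring.
  rewrite (le_lt_trans (ler_normB _ _))// (lt_trans (ltrD yqi (qx i)))//.
  by rewrite [ltRHS]splitr ltrD.
by apply/cubeE => i; rewrite !mxE/= -sE; exact: qx.
Qed.

Lemma continuous_measurable_rV (h : 'rV[R]_n -> R) :
  continuous h -> measurable_fun setT h.
Proof.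
move=> /continuousP ch; apply: (measurability _ (RGenOpens.measurableE R)).
move=> _ [_ [a [b ->] <-]]; rewrite setTI; apply: open_measurable_rV.
exact/ch/interval_open.
Qed.

Lemma lebesgue_rV_cube_gt0 q r : 0 < r -> (0 < lebesgue_rV R n (cube q r))%E.
Proof.
move=> r0.
pose A (i : 'I_n) : set R := `]q ord0 i - r, q ord0 i + r[%classic.
have -> : lebesgue_rV R n (cube q r) = (\prod_(i < n) lebesgue_measure (A i))%E.
  by apply: (lebesgue_rV_box (A := A)) => i; exact: measurable_itv.
rewrite (eq_bigr (fun=> (2 * r)%:E)) => [|i _].
  by rewrite prodEFin prodr_const card_ord lte_fin exprn_gt0// mulr_gt0.
rewrite /A lebesgue_measure_itv/= lte_fin ifT; last by lra.
by rewrite -EFinB; congr EFin; ring.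
Qed.

(** By continuity [h ^+ 2] exceeds half of its value at [x] on a whole cube, and cubes have positive
    measure. This is what turns a nonzero function into one of positive mass. *)
Lemma integral_sqr_gt0 (h : 'rV[R]_n -> R) : continuous h ->
  (exists x, h x != 0) -> (0 < \int[lebesgue_rV R n]_x (h x ^+ 2)%:E)%E.
Proof.
move=> ch [x hx].
have mh := continuous_measurable_rV ch.
have hx2 : 0 < h x ^+ 2 by rewrite exprn_even_gt0.
have h2x : (fun y => h y * h y) @ x --> h x * h x by exact: (cvgM (ch x) (ch x)).
have [r r0 xr] : exists2 r, 0 < r & cube x r `<=` [set y | h x ^+ 2 / 2 < h y ^+ 2].
  by apply: cube_nbhs; apply: (cvgr_gt _ h2x); lra.
apply: (@lt_le_trans _ _ (\int[lebesgue_rV R n]_(y in cube x r) (h x ^+ 2 / 2)%:E)%E).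
  rewrite integral_cst; last exact: measurable_cube.
  by rewrite mule_gt0//; [rewrite lte_fin divr_gt0|exact: lebesgue_rV_cube_gt0].
apply: (@le_trans _ _ (\int[lebesgue_rV R n]_(y in cube x r) (h y ^+ 2)%:E)%E).
  apply: ge0_le_integral => //.
  - exact: measurable_cube.
  - by move=> y _; rewrite lee_fin; lra.
  - by apply/measurable_EFinP; apply: measurable_funTS; exact: measurable_funX.
  - by move=> y /xr /= /ltW; rewrite lee_fin.
apply: ge0_subset_integral => //; first exact: measurable_cube.
- by apply/measurable_EFinP; exact: measurable_funX.
- by move=> y _; rewrite lee_fin sqr_ge0.
Qed.

End continuous_rV.

(** * Fourier integrals of real functions *)

Section integration_lemmas.
Context d1 d2 (T1 : measurableType d1) (T2 : measurableType d2) (R : realType).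
Variables (m1 : {sigma_finite_measure set T1 -> \bar R}).
Variables (m2 : {sigma_finite_measure set T2 -> \bar R}).

Lemma EFin_Rintegral (f : T1 -> R) : m1.-integrable setT (EFin \o f) ->
  (\int[m1]_x f x)%:E = (\int[m1]_x (f x)%:E)%E.
Proof. by move=> fi; rewrite /Rintegral fineK// integrable_fin_num. Qed.

Lemma integrable_tensor (f : T1 -> R) (g : T2 -> R) :
  m1.-integrable setT (EFin \o f) -> m2.-integrable setT (EFin \o g) ->
  (m1 \x m2)%E.-integrable setT (fun p => (f p.1 * g p.2)%:E).
Proof.
move=> fi gi.
have mf : measurable_fun setT f by apply/measurable_EFinP; exact: measurable_int fi.
have mg : measurable_fun setT g by apply/measurable_EFinP; exact: measurable_int gi.
apply/integrable12ltyP.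
  apply/measurable_EFinP; apply: measurable_funM.
    exact: (measurableT_comp mf measurable_fst).
  exact: (measurableT_comp mg measurable_snd).
have mg' : measurable_fun setT (fun y => `|g y|%:E).
  by apply/measurable_EFinP; apply: measurableT_comp.
under eq_integral => x _.
  under eq_integral => y _ do rewrite /= normrM EFinM.
  rewrite ge0_integralZl//.
  over.
have /integrableP[_ gfin] := gi; have /integrableP[_ ffin] := fi.
rewrite ge0_integralZr//; last 2 first.
- by apply/measurable_EFinP; apply: measurableT_comp.
- exact: integral_ge0.
by rewrite lte_mul_pinfty//; [exact: integral_ge0|rewrite ge0_fin_numE//; exact: integral_ge0].
Qed.

(** Tonelli gives the measurability of the integrals of the positive and negative parts separately,
    so no integrability of [f] is needed. *)
Lemma measurable_parametric_integral (f : T1 * T2 -> \bar R) :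
  measurable_fun setT f -> measurable_fun setT (fun x => \int[m2]_y f (x, y))%E.
Proof.
move=> mf.
pose fp (x : T1) := (\int[m2]_y (f^\+ (x, y)))%E.
pose fn (x : T1) := (\int[m2]_y (f^\- (x, y)))%E.
rewrite (_ : (fun x => _) = (fun x => fp x - fn x)%E); last first.
  apply/funext => x; rewrite integralE.
  by rewrite -[X in integral _ _ (X^\+)%E]/(f \o (fun y => (x, y))) funepos_comp
    -[X in integral _ _ (X^\-)%E]/(f \o (fun y => (x, y))) funeneg_comp.
apply: emeasurable_funB.
  exact: (measurable_fun_fubini_tonelli_F (f^\+)%E (measurable_funepos mf) (funepos_ge0 f)).
exact: (measurable_fun_fubini_tonelli_F (f^\-)%E (measurable_funeneg mf) (funeneg_ge0 f)).
Qed.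

End integration_lemmas.

Section measurable_vectors.
Context d (T : measurableType d) {R : realType} {n : nat}.
Implicit Types f g : T -> 'rV[R]_n.

Lemma measurable_fun_dotp f g : measurable_fun setT f -> measurable_fun setT g ->
  measurable_fun setT (fun t => dotp (f t) (g t)).
Proof.
move=> mf mg; apply: measurable_sum => i; apply: measurable_funM.
  exact: (measurableT_comp (measurable_coord i) mf).
exact: (measurableT_comp (measurable_coord i) mg).
Qed.

Lemma measurable_fun_affine (s : R) f g :
  measurable_fun setT f -> measurable_fun setT g ->
  measurable_fun setT (fun t => s *: f t + g t).
Proof.
move=> mf mg; apply/measurable_fun_rVP => i; under eq_fun do rewrite !mxE.
apply: measurable_funD; last exact: (measurableT_comp (measurable_coord i) mg).
by apply: measurable_funM => //; exact: (measurableT_comp (measurable_coord i) mf).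
Qed.

End measurable_vectors.

Section dotp_theory.
Context {R : realType} {n : nat}.
Implicit Types x y z : 'rV[R]_n.

Lemma dotpDl x y z : dotp (x + y) z = dotp x z + dotp y z.
Proof. by rewrite /dotp -big_split; apply: eq_bigr => i _; rewrite mxE mulrDl. Qed.

Lemma dotpZl (s : R) x z : dotp (s *: x) z = s * dotp x z.
Proof. by rewrite /dotp mulr_sumr; apply: eq_bigr => i _; rewrite mxE mulrA. Qed.

Lemma dotpC x y : dotp x y = dotp y x.
Proof. by apply: eq_bigr => i _; rewrite mulrC. Qed.

Lemma dotpZr (s : R) x z : dotp x (s *: z) = s * dotp x z.
Proof. by rewrite dotpC dotpZl dotpC. Qed.

Lemma dotpBl x y z : dotp (x - y) z = dotp x z - dotp y z.
Proof. by rewrite dotpDl -scaleN1r dotpZl mulN1r. Qed.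

End dotp_theory.

Section fourier_integrals.
Context {R : realType} {n : nat}.
Notation mu := (lebesgue_rV R n).
Variable u : 'rV[R]_n -> R.
Hypothesis ui : mu.-integrable setT (EFin \o u).

Let mu_meas : measurable_fun setT u.
Proof. by apply/measurable_EFinP; exact: measurable_int ui. Qed.

Definition phase (x xi : 'rV[R]_n) : R := 2 * pi * dotp x xi.

(** For real [u] the Fourier transform is [cosT - i sinT]. *)
Definition cosT (xi : 'rV[R]_n) : R := \int[mu]_x (u x * cos (phase x xi)).
Definition sinT (xi : 'rV[R]_n) : R := \int[mu]_x (u x * sin (phase x xi)).
(* The squared modulus of the Fourier transform of the real function [u]. *)
Definition powerT (xi : 'rV[R]_n) : R := cosT xi ^+ 2 + sinT xi ^+ 2.

Lemma measurable_fun_phase d (T : measurableType d) (f g : T -> 'rV[R]_n) :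
  measurable_fun setT f -> measurable_fun setT g ->
  measurable_fun setT (fun t => phase (f t) (g t)).
Proof. by move=> mf mg; apply: measurable_funM => //; exact: measurable_fun_dotp. Qed.

Lemma integrable_mul_bounded (h : 'rV[R]_n -> R) : measurable_fun setT h ->
  (forall x, `|h x| <= 1) -> mu.-integrable setT (fun x => (u x * h x)%:E).
Proof.
move=> mh h1; have ni := integrable_norm ui.
apply: le_integrable_EFin ni; first exact: measurable_funM.
by move=> x; rewrite normrM ler_piMr.
Qed.

Let measurable_cos : measurable_fun setT (@cos R).
Proof. by apply: continuous_measurable_fun; exact: continuous_cos. Qed.

Let measurable_sin : measurable_fun setT (@sin R).
Proof. by apply: continuous_measurable_fun; exact: continuous_sin. Qed.

Lemma measurable_fun_cosT_phase d (T : measurableType d) (f g : T -> 'rV[R]_n) :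
  measurable_fun setT f -> measurable_fun setT g ->
  measurable_fun setT (fun t => cos (phase (f t) (g t))).
Proof. by move=> mf mg; apply: (measurableT_comp measurable_cos); exact: measurable_fun_phase. Qed.

Lemma measurable_fun_sinT_phase d (T : measurableType d) (f g : T -> 'rV[R]_n) :
  measurable_fun setT f -> measurable_fun setT g ->
  measurable_fun setT (fun t => sin (phase (f t) (g t))).
Proof. by move=> mf mg; apply: (measurableT_comp measurable_sin); exact: measurable_fun_phase. Qed.

Lemma integrable_cosT xi : mu.-integrable setT (fun x => (u x * cos (phase x xi))%:E).
Proof.
apply: integrable_mul_bounded => [|x]; last exact: cos_norm_le1.
by apply: measurable_fun_cosT_phase => //; exact: measurable_id.
Qed.

Lemma integrable_sinT xi : mu.-integrable setT (fun x => (u x * sin (phase x xi))%:E).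
Proof.
apply: integrable_mul_bounded => [|x]; last exact: sin_norm_le1.
by apply: measurable_fun_sinT_phase => //; exact: measurable_id.
Qed.

Lemma measurable_cosT : measurable_fun setT cosT.
Proof.
apply: (measurableT_comp (fine_measurable (@measurableT _ (\bar R)))).
pose f (p : 'rV[R]_n * 'rV[R]_n) := (u p.2 * cos (phase p.2 p.1))%:E.
apply: (@measurable_parametric_integral _ _ _ _ _ mu f).
apply/measurable_EFinP; apply: measurable_funM.
  exact: (measurableT_comp mu_meas measurable_snd).
by apply: measurable_fun_cosT_phase; [exact: measurable_snd|exact: measurable_fst].
Qed.

Lemma measurable_sinT : measurable_fun setT sinT.
Proof.
apply: (measurableT_comp (fine_measurable (@measurableT _ (\bar R)))).
pose f (p : 'rV[R]_n * 'rV[R]_n) := (u p.2 * sin (phase p.2 p.1))%:E.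
apply: (@measurable_parametric_integral _ _ _ _ _ mu f).
apply/measurable_EFinP; apply: measurable_funM.
  exact: (measurableT_comp mu_meas measurable_snd).
by apply: measurable_fun_sinT_phase; [exact: measurable_snd|exact: measurable_fst].
Qed.

Lemma measurable_powerT : measurable_fun setT powerT.
Proof.
apply: measurable_funD; apply: measurable_funX.
  exact: measurable_cosT.
exact: measurable_sinT.
Qed.

Lemma powerT_ge0 xi : 0 <= powerT xi.
Proof. by rewrite addr_ge0 ?sqr_ge0. Qed.

Let L1 : R := \int[mu]_x `|u x|.

Lemma cosT_norm_le xi : `|cosT xi| <= L1.
Proof.
apply: (le_trans (le_normr_Rintegral measurableT (integrable_cosT xi))).
apply: le_Rintegral => //; first exact: (integrable_norm (integrable_cosT xi)).
  exact: (integrable_norm ui).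
by move=> x _; rewrite normrM ler_piMr// cos_norm_le1.
Qed.

Lemma sinT_norm_le xi : `|sinT xi| <= L1.
Proof.
apply: (le_trans (le_normr_Rintegral measurableT (integrable_sinT xi))).
apply: le_Rintegral => //; first exact: (integrable_norm (integrable_sinT xi)).
  exact: (integrable_norm ui).
by move=> x _; rewrite normrM ler_piMr// sin_norm_le1.
Qed.

(** The real part of exp(2 pi i x.xi) times the transform of [u] at [xi]. It keeps the double
    integral for [powerT] real: [shiftTE] produces the integral in y and [powerTE] the one in x. *)
Definition shiftT (x xi : 'rV[R]_n) : R :=
  cos (phase x xi) * cosT xi + sin (phase x xi) * sinT xi.

Lemma shiftTE x xi :
  (\int[mu]_y (u y * cos (phase x xi - phase y xi))%:E = (shiftT x xi)%:E)%E.
Proof.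
transitivity (\int[mu]_y ((cos (phase x xi))%:E * (u y * cos (phase y xi))%:E +
    (sin (phase x xi))%:E * (u y * sin (phase y xi))%:E))%E.
  apply: eq_integral => y _; rewrite -!EFinM -EFinD; congr EFin.
  by rewrite cosB; ring.
have ic := integrable_cosT xi; have is' := integrable_sinT xi.
rewrite integralD//; [|exact: integrableZl..].
by rewrite !integralZl// /shiftT EFinD !EFinM !EFin_Rintegral.
Qed.

Lemma powerTE xi :
  (\int[mu]_x (u x * shiftT x xi)%:E = (powerT xi)%:E)%E.
Proof.
transitivity (\int[mu]_x ((cosT xi)%:E * (u x * cos (phase x xi))%:E +
    (sinT xi)%:E * (u x * sin (phase x xi))%:E))%E.
  apply: eq_integral => y _; rewrite -!EFinM -EFinD; congr EFin.
  by rewrite /shiftT; ring.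
have ic := integrable_cosT xi; have is' := integrable_sinT xi.
rewrite integralD//; [|exact: integrableZl..].
by rewrite !integralZl// -!EFin_Rintegral.
Qed.

Lemma shiftT_norm_le x xi : `|shiftT x xi| <= 2 * L1.
Proof.
rewrite mulr2n mulrDl !mul1r (le_trans (ler_normD _ _))// lerD// normrM.
  by rewrite (le_trans _ (cosT_norm_le xi))// ler_piMl// cos_norm_le1.
by rewrite (le_trans _ (sinT_norm_le xi))// ler_piMl// sin_norm_le1.
Qed.

Lemma measurable_fun_shiftT d (T : measurableType d) (f g : T -> 'rV[R]_n) :
  measurable_fun setT f -> measurable_fun setT g ->
  measurable_fun setT (fun t => shiftT (f t) (g t)).
Proof.
move=> mf mg; apply: measurable_funD; apply: measurable_funM.
- exact: measurable_fun_cosT_phase.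
- exact: (measurableT_comp measurable_cosT mg).
- exact: measurable_fun_sinT_phase.
- exact: (measurableT_comp measurable_sinT mg).
Qed.

End fourier_integrals.

(** * Plancherel's identity *)

Section plancherel.
Context {R : realType} {n : nat}.
Notation mu := (lebesgue_rV R n).
Variables (u : 'rV[R]_n -> R) (M : R).
Hypothesis ui : mu.-integrable setT (EFin \o u).
Hypothesis uc : continuous u.
Hypothesis uM : forall x, `|u x| <= M.

Let mu_meas : measurable_fun setT u.
Proof. by apply/measurable_EFinP; exact: measurable_int ui. Qed.

Definition expweight (x : 'rV[R]_n) : R := prodf (@laplace R) x.

Let expweight_ge0 x : 0 <= expweight x.
Proof. by apply: prodf_ge0 => t; exact: expR_ge0. Qed.

Let measurable_expweight : measurable_fun setT expweight.
Proof. by apply: measurable_prodf; exact: measurable_laplace. Qed.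

Let expweightE (e : R) x : 0 <= e ->
  expweight (e *: x) = expR (- (e * \sum_(i < n) `|x ord0 i|)).
Proof.
move=> e0; rewrite /expweight /prodf mulr_sumr -sumrN expR_sum.
by apply: eq_bigr => i _; rewrite /laplace mxE normrM ger0_norm.
Qed.

(** The cosine transform of [laplace] at the frequency [2 * pi * t]; with this normalisation its
    total mass is 1. *)
Definition poisson1 (t : R) : R := 2 / oneDsqr (2 * pi * t).
Definition poisson (x : 'rV[R]_n) : R := prodf poisson1 x.

Let oneDsqr_gt0 (t : R) : 0 < oneDsqr t.
Proof. by rewrite (lt_le_trans ltr01 (oneDsqr_ge1 t)). Qed.

Let poisson1_ge0 t : 0 <= poisson1 t.
Proof. by rewrite divr_ge0// ltW. Qed.

Let measurable_poisson1 : measurable_fun setT poisson1.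
Proof.
apply: continuous_measurable_fun => t; apply: cvgM; first exact: cvg_cst.
apply: (continuous_comp (f := fun t : R => 2 * pi * t) (g := fun t : R => (oneDsqr t)^-1)).
  by apply: cvgM; [exact: cvg_cst|exact: cvg_id].
exact: continuous_oneDsqrV.
Qed.

Let integral_poisson1 : (\int[lebesgue_measure]_t (poisson1 t)%:E = 1%:E)%E.
Proof.
have pi2 : 2 * pi != 0 :> R by rewrite mulf_neq0// gt_eqF// pi_gt0.
have mo : measurable_fun setT (fun t : R => (oneDsqr t)^-1%:E).
  by apply/measurable_EFinP; apply: continuous_measurable_fun; exact: continuous_oneDsqrV.
have o0 (t : R) : (0 <= ((oneDsqr t)^-1)%:E)%E by rewrite lee_fin invr_ge0 ltW.
have := ge0_integral_affine1 0 pi2 mo o0.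
rewrite integral_oneDsqrV ger0_norm; last by rewrite mulr_ge0// pi_ge0.
move=> /(congr1 (fun x => (pi^-1)%:E * x)%E).
rewrite muleA -!EFinM mulrCA mulVf ?mulr1; last by rewrite gt_eqF// pi_gt0.
rewrite -ge0_integralZl//.
- by move=> <-; apply: eq_integral => t _; rewrite addr0.
- apply/measurable_EFinP; apply: continuous_measurable_fun => t.
  apply: (continuous_comp (f := fun t : R => 2 * pi * t + 0) (g := fun t : R => (oneDsqr t)^-1)).
    apply: cvgD; last exact: cvg_cst.
    by apply: cvgM; [exact: cvg_cst|exact: cvg_id].
  exact: continuous_oneDsqrV.
Qed.

Let integrable_poisson : mu.-integrable setT (EFin \o poisson).
Proof. exact: integrable_prodf integral_poisson1. Qed.

Let integral_poisson : (\int[mu]_x (poisson x)%:E = 1%:E)%E.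
Proof. by rewrite (integral_prodf n measurable_poisson1 _ integral_poisson1)// expr1n. Qed.

Let poisson_ge0 x : 0 <= poisson x. Proof. exact: prodf_ge0. Qed.

Let L1 : R := \int[mu]_x `|u x|.

Let integrable_shiftT xi : mu.-integrable setT (fun x => (u x * shiftT u x xi)%:E).
Proof.
apply: (le_integrable_EFin (g := fun x => (2 * L1) * `|u x|)).
- apply: measurable_funM => //; apply: (measurable_fun_shiftT ui) => //.
- by move=> x; rewrite normrM mulrC ler_wpM2r//; exact: shiftT_norm_le.
- under [X in integrable _ _ X]eq_fun do rewrite /= EFinM.
  exact: integrableZl (integrable_norm ui).
Qed.

Let measurable_scale (s : R) d (T : measurableType d) (f : T -> 'rV[R]_n) :
  measurable_fun setT f -> measurable_fun setT (fun t => s *: f t).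
Proof.
move=> mf; apply/measurable_fun_rVP => i; under eq_fun do rewrite !mxE.
by apply: measurable_funM => //; exact: (measurableT_comp (measurable_coord i) mf).
Qed.

(** The majorant [expweight eta * (2 * L1 * |u x|)] is integrable only thanks to the weight. Below
    [s] is the inverse of the scale [e]. *)
Let fubini1 (s : R) :
  (\int[mu]_eta (expweight eta * powerT u (s *: eta))%:E =
   \int[mu]_x \int[mu]_eta (expweight eta * (u x * shiftT u x (s *: eta)))%:E)%E.
Proof.
pose f p := (expweight p.1 * (u p.2 * shiftT u p.2 (s *: p.1)))%:E.
transitivity (\int[mu]_eta \int[mu]_x f (eta, x))%E.
  apply: eq_integral => eta _; rewrite EFinM -powerTE// -integralZl//.
apply: (@Fubini _ _ _ _ _ mu mu f).
apply: (le_integrable_EFin (g := fun p => expweight p.1 * ((2 * L1) * `|u p.2|))).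
- apply: measurable_funM; first exact: (measurableT_comp measurable_expweight measurable_fst).
  apply: measurable_funM; first exact: (measurableT_comp mu_meas measurable_snd).
  apply: (measurable_fun_shiftT ui) => //.
  by apply: measurable_scale; exact: measurable_fst.
- move=> p; rewrite normrM ger0_norm// ler_wpM2l// normrM mulrC ler_wpM2r//.
  exact: shiftT_norm_le.
apply: (integrable_tensor (g := fun x => (2 * L1) * `|u x|)).
  exact: integrable_prodf_laplace.
under [X in integrable _ _ X]eq_fun do rewrite /= EFinM.
exact: integrableZl (integrable_norm ui).
Qed.

Let kern (s : R) (x y : 'rV[R]_n) : R :=
  prodf (fun t => 2 / oneDsqr t) ((2 * pi * s) *: (x - y)).

(** With x fixed, the integral over [eta] is a cosine transform of the weight and has the closed
    form [kern]. The integrability clause is what the signed change of variables in [smoothed_power]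
    requires. *)
Let fubini2 (s : R) x :
  (\int[mu]_eta (expweight eta * (u x * shiftT u x (s *: eta)))%:E =
   \int[mu]_y (u x * (u y * kern s x y))%:E)%E /\
  mu.-integrable setT (fun y => (u x * (u y * kern s x y))%:E).
Proof.
pose f (p : 'rV[R]_n * 'rV[R]_n) := (expweight p.2 * (u x * (u p.1 *
  cos (phase x (s *: p.2) - phase p.1 (s *: p.2)))))%:E.
have fi : (mu \x mu)%E.-integrable setT f.
  apply: (le_integrable_EFin (g := fun p => (`|u x| * `|u p.1|) * expweight p.2)).
  - apply: measurable_funM; first exact: (measurableT_comp measurable_expweight measurable_snd).
    apply: measurable_funM => //.
    apply: measurable_funM; first exact: (measurableT_comp mu_meas measurable_fst).
    apply: measurableT_comp; first by apply: continuous_measurable_fun; exact: continuous_cos.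
    apply: measurable_funB; apply: measurable_fun_phase => //;
      by apply: measurable_scale; exact: measurable_snd.
  - move=> p; rewrite !normrM ger0_norm// [leRHS]mulrC ler_wpM2l// ler_wpM2l//.
    by rewrite ler_piMr// cos_norm_le1.
  apply: (integrable_tensor (f := fun y => `|u x| * `|u y|)).
    under [X in integrable _ _ X]eq_fun do rewrite /= EFinM.
    exact: integrableZl (integrable_norm ui).
  exact: integrable_prodf_laplace.
have kE y : (\int[mu]_eta f (y, eta) = (u x * (u y * kern s x y))%:E)%E.
  under eq_integral => eta _.
    rewrite /f/= mulrC -mulrA -mulrA (mulrC _ (expweight _)).
    rewrite (_ : phase x _ - _ = dotp ((2 * pi * s) *: (x - y)) eta + 0); last first.
      by rewrite addr0 /phase !dotpZr dotpZl dotpBl; ring.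
    rewrite mulrA EFinM.
    over.
  rewrite integralZl//; last exact: integrable_prodf_laplace_cos.
  by rewrite integral_prodf_laplace_cos -EFinM cos0 mul1r mulrA.
split.
  transitivity (\int[mu]_eta \int[mu]_y f (y, eta))%E.
    apply: eq_integral => eta _; rewrite mulrA EFinM -shiftTE// -integralZl//.
      by apply: eq_integral => y _; rewrite -EFinM /f/= mulrA.
    apply: (integrable_mul_bounded ui) => [|y]; last exact: cos_norm_le1.
    apply: measurableT_comp; first by apply: continuous_measurable_fun; exact: continuous_cos.
    by apply: measurable_funB => //; apply: measurable_fun_phase => //; exact: measurable_id.
  rewrite -(@Fubini _ _ _ _ _ mu mu f)//.
  by apply: eq_integral => y _; rewrite kE.
have := integrable_fubini_F fi.
by apply: eq_integrable => // y _; rewrite -kE.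
Qed.

(** The substitution y = x - e z leaves [e] only inside the argument of [u], so boundedness of [u]
    yields a majorant independent of [e]. *)
Let smoothed (e : R) (p : 'rV[R]_n * 'rV[R]_n) : R :=
  u p.1 * (u (p.1 - e *: p.2) * poisson p.2).

Let measurable_smoothed e : measurable_fun setT (smoothed e).
Proof.
apply: measurable_funM; first exact: (measurableT_comp mu_meas measurable_fst).
apply: measurable_funM; last first.
  by apply: (measurableT_comp _ measurable_snd); exact: measurable_prodf.
apply: (measurableT_comp mu_meas).
rewrite (_ : (fun x => _) = (fun x : 'rV[R]_n * 'rV[R]_n => (- e) *: x.2 + x.1)); last first.
  by apply/funext => x; rewrite scaleNr addrC.
by apply: measurable_fun_affine; [exact: measurable_snd|exact: measurable_fst].
Qed.

Let smoothed_le e p : `|smoothed e p| <= (M * `|u p.1|) * poisson p.2.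
Proof.
rewrite /smoothed !normrM (ger0_norm (poisson_ge0 _)) mulrA ler_wpM2r// mulrC ler_wpM2r//.
Qed.

Let integrable_smoothed_bound :
  (mu \x mu)%E.-integrable setT (fun p => (M * `|u p.1| * poisson p.2)%:E).
Proof.
apply: (integrable_tensor (f := fun x => M * `|u x|) (g := poisson)) => //.
under [X in integrable _ _ X]eq_fun do rewrite /= EFinM.
exact: integrableZl (integrable_norm ui).
Qed.

Let integrable_smoothed e : (mu \x mu)%E.-integrable setT (EFin \o smoothed e).
Proof.
exact: (le_integrable_EFin (measurable_smoothed e) (smoothed_le e) integrable_smoothed_bound).
Qed.

(** Rescaling by eta = e xi in frequency and by y = x - e z in space each produce a factor [e ^+ n],
    and the two cancel. *)
Let smoothed_power (e : R) : 0 < e ->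
  (\int[mu]_xi (expweight (e *: xi) * powerT u xi)%:E =
   \int[mu \x mu]_p (smoothed e p)%:E)%E.
Proof.
move=> e0; have e_neq0 : e != 0 by rewrite gt_eqF.
have en0 : e ^+ n != 0 by rewrite expf_neq0.
pose f (eta : 'rV[R]_n) := (expweight eta * powerT u (e^-1 *: eta))%:E.
have mf : measurable_fun setT f.
  apply/measurable_EFinP; apply: measurable_funM => //.
  apply: (measurableT_comp (measurable_powerT ui)).
  by apply: measurable_scale; exact: measurable_id.
have f0 x : (0 <= f x)%E by rewrite lee_fin mulr_ge0// powerT_ge0.
have := ge0_integral_affine 0 e_neq0 mf f0.
under eq_integral => x _ do rewrite /f addr0 scalerA mulVf// scale1r.
rewrite fubini1 ger0_norm ?ltW//.
under [X in _ = X -> _]eq_integral => x _.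
  have [-> iG] := fubini2 e^-1 x.
  have ne0 : - e != 0 by rewrite oppr_eq0.
  rewrite -(integral_affine x ne0 iG) normrN ger0_norm ?ltW//.
  under eq_integral => z _.
    rewrite (_ : u x * _ = smoothed e (x, z)); last first.
      rewrite /smoothed /= scaleNr addrC /kern; congr (_ * (_ * _)).
      apply: eq_bigr => i _; rewrite /poisson1 !mxE; congr (2 / oneDsqr _).
      by field.
    over.
  over.
rewrite integralZl//; last exact: (integrable_fubini_F (integrable_smoothed e)).
rewrite (integral12_prod_meas1 (integrable_smoothed e)).
move=> /(congr1 (fun x => ((e ^+ n)^-1)%:E * x)%E).
by rewrite !muleA -EFinM mulVf// !mul1e.
Qed.

Let eps (m : nat) : R := m.+1%:R^-1.

Let eps_gt0 m : 0 < eps m. Proof. by rewrite invr_gt0. Qed.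

Let eps_cvg0 : eps @ \oo --> 0. Proof. exact: cvg_harmonic. Qed.

(** Continuity of [u] gives the pointwise limit [smoothed 0], which is u(x)^2 times [poisson]; the
    unit mass of [poisson] then removes the second variable. *)
Let cvg_smoothed :
  (\int[mu \x mu]_p (smoothed (eps m) p)%:E @[m --> \oo] -->
   \int[mu]_x (u x ^+ 2)%:E)%E.
Proof.
have -> : (\int[mu]_x (u x ^+ 2)%:E = \int[mu \x mu]_p (smoothed 0 p)%:E)%E.
  rewrite -(integral12_prod_meas1 (integrable_smoothed 0)).
  apply: eq_integral => x _; rewrite /fubini_F.
  under eq_integral => z _ do rewrite /smoothed/= scale0r subr0 mulrA -expr2 EFinM.
  by rewrite integralZl// integral_poisson mule1.
have mfm m : measurable_fun setT (EFin \o smoothed (eps m)).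
  by apply/measurable_EFinP; exact: measurable_smoothed.
have mf0 : measurable_fun setT (EFin \o smoothed 0).
  by apply/measurable_EFinP; exact: measurable_smoothed.
have cv : {ae (mu \x mu)%E, forall p, setT p ->
    (EFin \o smoothed (eps m)) p @[m --> \oo] --> (EFin \o smoothed 0) p}.
  apply: aeW => -[x z] _ /=; apply: cvg_EFin; first exact: nearW.
  apply: cvgM; first exact: cvg_cst.
  apply: cvgM; last exact: cvg_cst.
  apply: (@cvg_comp _ _ _ (fun m => x - eps m *: z) u _ (nbhs (x - 0 *: z))); last exact: uc.
  apply: cvgB; first exact: cvg_cst.
  exact: (cvgZr_tmp (a := z) eps_cvg0).
have bd : {ae (mu \x mu)%E, forall p m, setT p ->
    (`|(EFin \o smoothed (eps m)) p| <= (M * `|u p.1| * poisson p.2)%:E)%E}.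
  by apply: aeW => p m _; rewrite /= lee_fin; exact: smoothed_le.
by have [_ _] := dominated_convergence measurableT mfm mf0 cv integrable_smoothed_bound bd.
Qed.

Let cvg_power :
  (\int[mu]_xi (expweight (eps m *: xi) * powerT u xi)%:E @[m --> \oo] -->
   \int[mu]_xi (powerT u xi)%:E)%E.
Proof.
pose g (m : nat) (xi : 'rV[R]_n) := (expweight (eps m *: xi) * powerT u xi)%:E.
have gE m xi : g m xi = (expR (- (eps m * \sum_(i < n) `|xi ord0 i|)) * powerT u xi)%:E.
  by rewrite /g expweightE// ltW.
have S0 (xi : 'rV[R]_n) : 0 <= \sum_(i < n) `|xi ord0 i| by exact: sumr_ge0.
have mg m : measurable_fun setT (g m).
  apply/measurable_EFinP; apply: measurable_funM; last exact: measurable_powerT.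
  apply: (measurableT_comp measurable_expweight).
  by apply: measurable_scale; exact: measurable_id.
have g0 m xi : setT xi -> (0 <= g m xi)%E.
  by move=> _; rewrite lee_fin mulr_ge0// powerT_ge0.
have gnd xi : setT xi -> {homo g ^~ xi : m k / (m <= k)%N >-> (m <= k)%E}.
  move=> _ m k mk; rewrite !gE lee_fin ler_wpM2r ?powerT_ge0// ler_expR lerN2.
  by rewrite ler_wpM2r// lef_pV2 ?posrE// ler_nat.
rewrite (_ : \int[mu]_xi (powerT u xi)%:E = \int[mu]_x limn (g ^~ x))%E.
  exact: (cvg_monotone_convergence measurableT mg g0 gnd).
apply: eq_integral => xi _; apply/esym/cvg_lim => //.
under eq_fun do rewrite gE.
apply: cvg_EFin; first exact: nearW.
have cS : (eps m * \sum_(i < n) `|xi ord0 i|) @[m --> \oo] --> 0.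
  rewrite -[X in _ --> X](mul0r (\sum_(i < n) `|xi ord0 i|)).
  exact: (cvgM eps_cvg0 (cvg_cst (\sum_(i < n) `|xi ord0 i|))).
have cE : expR (- (eps m * \sum_(i < n) `|xi ord0 i|)) @[m --> \oo] --> (1 : R).
  rewrite -(@expR0 R) -[X in expR X]oppr0; apply: continuous_cvg; first exact: continuous_expR.
  exact: cvgN cS.
rewrite -[X in _ --> X]mul1r.
exact: (cvgM cE (cvg_cst (powerT u xi))).
Qed.

Theorem plancherel :
  (\int[mu]_xi (powerT u xi)%:E = \int[mu]_x (u x ^+ 2)%:E)%E.
Proof.
have := cvg_smoothed.
rewrite (_ : (fun m => _) = fun m =>
    (\int[mu]_xi (expweight (eps m *: xi) * powerT u xi)%:E)%E).
  exact: (cvg_unique _ cvg_power).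
by apply/funext => m; rewrite smoothed_power.
Qed.

End plancherel.

(** * Integration by parts *)

Section derivative_along.
Context {R : realType} {n : nat}.
Notation mu := (lebesgue_rV R n).
Implicit Types (h dh : 'rV[R]_n -> R) (x : 'rV[R]_n) (i : 'I_n).

Definition line i h x : R -> R := fun t => h (t *: delta_mx ord0 i + x).

(** Phrased on lines so that the product and chain rules for functions of one real variable apply.
    Asking for the derivative at 0 only is enough, because every point of a line is the origin of
    another one ([is_derive_line]). *)
Definition deriv_along i h dh := forall x, is_derive (0 : R) (1 : R) (line i h x) (dh x).

Lemma is_derive_line i h dh x (t : R) : deriv_along i h dh ->
  is_derive t (1 : R) (line i h x) (dh (t *: delta_mx ord0 i + x)).
Proof.
move=> dhP; have [] := dhP (t *: delta_mx ord0 i + x).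
rewrite /derivable /derive /=.
under eq_fun do rewrite /line addr0 scale0r add0r addrA -scalerDl.
move=> d1 d2; apply: DeriveDef; rewrite /derivable /derive /=.
  by under eq_fun do rewrite /line; exact: d1.
by under eq_fun do rewrite /line; exact: d2.
Qed.

Lemma derivable_deriv_along i h :
  (forall x, derivable h x (delta_mx ord0 i)) ->
  deriv_along i h (fun x => 'D_(delta_mx ord0 i) h x).
Proof.
move=> dh x; apply: DeriveDef; rewrite /derivable /derive /=.
  under eq_fun do rewrite /line addr0 scale0r add0r [_ *: 1]mulr1.
  exact: dh.
by under eq_fun do rewrite /line addr0 scale0r add0r [_ *: 1]mulr1.
Qed.

Definition lorentz x : R := prodf (fun t : R => (oneDsqr t)^-1) x.

Let oneDsqr_gt0 (t : R) : 0 < oneDsqr t.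
Proof. by rewrite (lt_le_trans ltr01 (oneDsqr_ge1 t)). Qed.

Let oneDsqrV_gt0 (t : R) : 0 < (oneDsqr t)^-1.
Proof. by rewrite invr_gt0. Qed.

Lemma lorentz_gt0 x : 0 < lorentz x.
Proof. by apply: prodr_gt0. Qed.

Lemma lorentz_le1 x : lorentz x <= 1.
Proof.
apply: prodr_ile1 => i _; rewrite ltW//=.
by rewrite invf_le1// oneDsqr_ge1.
Qed.

Lemma integrable_lorentz : mu.-integrable setT (EFin \o lorentz).
Proof.
apply: integrable_prodf (@integral_oneDsqrV R) => [|t]; last exact: ltW.
by apply: continuous_measurable_fun; exact: continuous_oneDsqrV.
Qed.

Lemma lorentz_shift i x (t : R) : `|t| <= 1 ->
  lorentz (t *: delta_mx ord0 i + x) <= 3 * lorentz x.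
Proof.
move=> t1; rewrite /lorentz /prodf (bigD1 i)//= [in leRHS](bigD1 i)//= mulrA.
rewrite (eq_bigr (fun j => (oneDsqr (x ord0 j))^-1)); last first.
  by move=> j ji; rewrite !mxE/= (negbTE ji) mulr0 add0r.
rewrite ler_wpM2r//; first by apply: prodr_ge0 => j _; exact: ltW.
rewrite !mxE !eqxx mulr1 ler_pdivlMr// mulrC ler_pdivrMr// /oneDsqr.
have : t ^+ 2 <= 1 by rewrite -real_normK ?num_real// expr_le1.
(* With y the i-th coordinate of x, 3 (1 + (t + y)^2) - (1 + y^2) equals (2 t + y)^2 + (t + y)^2 + 2
   (1 - t^2). *)
have : 0 <= (2 * t + x ord0 i) ^+ 2 by exact: sqr_ge0.
have : 0 <= (t + x ord0 i) ^+ 2 by exact: sqr_ge0.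
nra.
Qed.

Definition decays h := exists M : R, forall x, `|h x| <= M * lorentz x.

(** Continuity supplies measurability and decay supplies integrability. The class is closed under
    sums and products, so it contains every integrand that integration by parts produces. *)
Definition tame h := continuous h /\ decays h.

Lemma tame_measurable h : tame h -> measurable_fun setT h.
Proof. by move=> [ch _]; exact: continuous_measurable_rV. Qed.

Lemma integrable_cM (c : R) h : mu.-integrable setT (EFin \o h) ->
  mu.-integrable setT (EFin \o (fun x => c * h x)).
Proof.
move=> hi; rewrite (_ : EFin \o _ = fun x => c%:E * (EFin \o h) x)%E//.
exact: integrableZl.
Qed.

Lemma tame_integrable h : tame h -> mu.-integrable setT (EFin \o h).
Proof.
move=> th; have [_ [M hM]] := th.
apply: (le_integrable_EFin (tame_measurable th) hM).
exact: integrable_cM integrable_lorentz.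
Qed.

Lemma tame_bounded h : tame h -> exists M : R, forall x, `|h x| <= M.
Proof.
move=> [_ [M hM]]; exists M => x; rewrite (le_trans (hM x))//.
rewrite ler_piMr ?lorentz_le1//.
by rewrite -(pmulr_lge0 _ (lorentz_gt0 x)) (le_trans _ (hM x)).
Qed.

Lemma tameM_bounded h g (B : R) : tame h -> continuous g ->
  (forall x, `|g x| <= B) -> tame (fun x => h x * g x).
Proof.
move=> [ch [M hM]] cg gB; split; first by move=> x; exact: (cvgM (ch x) (cg x)).
exists (M * B) => x; rewrite normrM mulrAC ler_pM//.
Qed.

Lemma tameM h g : tame h -> tame g -> tame (fun x => h x * g x).
Proof.
move=> th tg; have [M gM] := tame_bounded tg.
by apply: tameM_bounded gM => //; exact: tg.1.
Qed.

Lemma tameD h g : tame h -> tame g -> tame (fun x => h x + g x).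
Proof.
move=> [ch [M hM]] [cg [B gB]]; split; first by move=> x; exact: (cvgD (ch x) (cg x)).
by exists (M + B) => x; rewrite mulrDl (le_trans (ler_normD _ _))// lerD.
Qed.

Lemma tameZ (c : R) h : tame h -> tame (fun x => c * h x).
Proof.
move=> [ch [M hM]]; split; first by move=> x; exact: (cvgM (cvg_cst c) (ch x)).
by exists (`|c| * M) => x; rewrite normrM -mulrA ler_wpM2l.
Qed.

Let eps (m : nat) : R := m.+1%:R^-1.

Let eps_gt0 m : 0 < eps m. Proof. by rewrite invr_gt0. Qed.

Let eps_le1 m : eps m <= 1. Proof. by rewrite invf_le1// ler1n. Qed.

Let eps_cvg0 : eps @ \oo --> 0. Proof. exact: cvg_harmonic. Qed.

Lemma integral_deriv_along i h dh : tame h -> tame dh -> deriv_along i h dh ->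
  \int[mu]_x dh x = 0.
Proof.
move=> th tdh dhP.
pose e : 'rV[R]_n := delta_mx ord0 i.
(* The factor [1 *:] puts the translation in the form [s *: x + c] of [integral_affine]. *)
pose q m x := (eps m)^-1 * (h (1 *: x + eps m *: e) - h x).
have hi := tame_integrable th.
have hsi m := integrable_affine (eps m *: e) (oner_neq0 R) hi.
have qi m : mu.-integrable setT (EFin \o q m).
  apply: integrable_cM.
  exact: (integrableB measurableT (hsi m) hi).
have mdh := tame_measurable tdh.
have q0 m : (\int[mu]_x (q m x)%:E = 0)%E.
  rewrite /q; under eq_integral => x _ do rewrite EFinM EFinB.
  rewrite integralZl//; last exact: (integrableB measurableT (hsi m) hi).
  rewrite integralB_EFin//; last exact: (hsi m).
  have := integral_affine (eps m *: e) (oner_neq0 R) hi.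
  rewrite normr1 expr1n mul1e => ->; rewrite subee ?mule0//.
  exact: integrable_fin_num.
have [_ [M dhM]] := tdh.
have M0 : 0 <= M.
  by rewrite -(pmulr_lge0 _ (lorentz_gt0 0)) (le_trans _ (dhM 0)).
have qE : forall k x, q k x = (eps k)^-1 * (line i h x (eps k) - line i h x 0).
  move=> k x.
  by rewrite /q /line scale1r scale0r add0r (addrC x).
(* The mean value theorem replaces the quotient by [dh] at a point shifted by less than
   [eps m <= 1], where [lorentz_shift] compares the bound with the one at [x]. *)
have qM : forall m x, `|q m x| <= M * (3 * lorentz x).
  move=> m x.
  have dl : forall t, t \in `]0, eps m[ ->
      is_derive t (1 : R) (line i h x) (dh (t *: e + x)).
    by move=> t _; exact: is_derive_line.
  have [|c] := MVT (eps_gt0 m) dl.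
    apply: derivable_within_continuous => t _.
    by have [] := is_derive_line x t dhP.
  rewrite in_itv/= => /andP[c0 ce].
  rewrite qE subr0 => ->; rewrite mulrC mulfK ?gt_eqF//.
  rewrite (le_trans (dhM _))// ler_wpM2l//; apply: lorentz_shift.
  rewrite ger0_norm; last exact: ltW.
  exact: le_trans (ltW ce) (eps_le1 m).
have qcvg : forall x, q m x @[m --> \oo] --> dh x.
  move=> x; have [d1 d2] := dhP x.
  have : (s^-1 *: ((line i h x \o shift 0) (s *: 1) - line i h x 0)) @[s --> 0^'] --> dh x.
    by rewrite -d2; exact: d1.
  (* The derivative is a limit over the punctured neighbourhood of 0, and [eps] never vanishes. *)
  have eps0' : eps @ \oo --> 0^'.
    move=> A /eps_cvg0[N _ NA]; exists N => // m /NA /=; apply.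
    exact: lt0r_neq0 (eps_gt0 m).
  move=> dhx; have := cvg_comp _ _ eps0' dhx.
  rewrite (_ : _ \o eps = fun m => q m x)//.
  by apply/funext => m; rewrite /= qE addr0 [_ *: 1]mulr1.
have mq m : measurable_fun setT (EFin \o q m) by exact: measurable_int (qi m).
have mdhE : measurable_fun setT (EFin \o dh) by exact/measurable_EFinP.
have cv : {ae mu, forall x, setT x -> (EFin \o q m) x @[m --> \oo] --> (EFin \o dh) x}.
  by apply: aeW => x _; apply: cvg_EFin; [exact: nearW|exact: qcvg].
have bi : mu.-integrable setT (fun x => (M * (3 * lorentz x))%:E).
  exact: (integrable_cM M (integrable_cM 3 integrable_lorentz)).
have bd : {ae mu, forall x m, setT x -> (`|(EFin \o q m) x| <= (M * (3 * lorentz x))%:E)%E}.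
  by apply: aeW => x m _; rewrite /= lee_fin.
have [_ _ qdh] := dominated_convergence measurableT mq mdhE cv bi bd.
have q0' : (\int[mu]_x (EFin \o q m) x @[m --> \oo] --> 0)%E.
  by apply: cvg_near_cst; apply: nearW => m; exact: q0.
have dh0 : (\int[mu]_x (EFin \o dh) x = 0)%E by exact: (cvg_unique _ qdh q0').
by rewrite /Rintegral dh0.
Qed.

End derivative_along.

(** * Transforms of derivatives and the one-coordinate inequality *)

Section derivative_identities.
Context {R : realType} {n : nat}.
Notation mu := (lebesgue_rV R n).
Variables (u du : 'rV[R]_n -> R) (i : 'I_n).
Hypothesis tu : tame u.
Hypothesis tdu : tame du.
Hypothesis txu : tame (fun x => x ord0 i * u x).
Hypothesis duP : deriv_along i u du.

Let e : 'rV[R]_n := delta_mx ord0 i.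

Let ui := tame_integrable tu.

Lemma continuous_phase xi : continuous (phase^~ xi : 'rV[R]_n -> R).
Proof.
have cd : continuous (fun x : 'rV[R]_n => dotp x xi).
  apply: continuous_big => [|j _ x]; first exact: add_continuous.
  exact: (cvgM (@coord_continuous _ _ _ ord0 j x) (cvg_cst (xi ord0 j))).
by move=> x; exact: (cvgM (cvg_cst (2 * pi)) (cd x)).
Qed.

Let phase_line (t : R) x xi :
  phase (t *: e + x) xi = t * (2 * pi * xi ord0 i) + phase x xi.
Proof.
rewrite /phase dotpDl dotpZl (_ : dotp e xi = xi ord0 i); first by ring.
rewrite /dotp (bigD1 i)//= mxE !eqxx mul1r big1 ?addr0// => j ji.
by rewrite mxE eqxx/= (negbTE ji) mul0r.
Qed.

Let continuous_cos_phase xi : continuous (fun x : 'rV[R]_n => cos (phase x xi)).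
Proof.
move=> x; apply: continuous_comp; last exact: continuous_cos.
exact: continuous_phase.
Qed.

Let continuous_sin_phase xi : continuous (fun x : 'rV[R]_n => sin (phase x xi)).
Proof.
move=> x; apply: continuous_comp; last exact: continuous_sin.
exact: continuous_phase.
Qed.

(** The derivative of [u] times the cosine of the phase integrates to zero. Cosine and sine
    transforms are exchanged, but [powerT] is only multiplied by a square. *)
Lemma cosT_deriv xi : cosT du xi = (2 * pi * xi ord0 i) * sinT u xi.
Proof.
set c := 2 * pi * xi ord0 i.
have tuc : tame (fun x => u x * cos (phase x xi)).
  by apply: tameM_bounded tu _ _ => // x; exact: cos_norm_le1.
have tduc : tame (fun x => du x * cos (phase x xi)).
  by apply: tameM_bounded tdu _ _ => // x; exact: cos_norm_le1.
have tus : tame (fun x => u x * sin (phase x xi)).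
  by apply: tameM_bounded tu _ _ => // x; exact: sin_norm_le1.
have dP : deriv_along i (fun x => u x * cos (phase x xi))
    (fun x => du x * cos (phase x xi) + (- c) * (u x * sin (phase x xi))).
  move=> x; have dux := duP x.
  rewrite (_ : line i _ x = fun t => line i u x t * cos (t * c + phase x xi)); last first.
    by apply/funext => t; rewrite /line -phase_line.
  apply: is_derive_eq; rewrite /line scale0r !add0r mul0r add0r /GRing.scale/=; ring.
have := integral_deriv_along tuc (tameD tduc (tameZ (- c) tus)) dP.
rewrite RintegralD//; [|exact: tame_integrable|exact/tame_integrable/tameZ].
rewrite RintegralZl//; last exact: tame_integrable.
by rewrite mulNr => /eqP; rewrite subr_eq0 => /eqP.
Qed.

Lemma sinT_deriv xi : sinT du xi = - (2 * pi * xi ord0 i) * cosT u xi.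
Proof.
set c := 2 * pi * xi ord0 i.
have tus : tame (fun x => u x * sin (phase x xi)).
  by apply: tameM_bounded tu _ _ => // x; exact: sin_norm_le1.
have tdus : tame (fun x => du x * sin (phase x xi)).
  by apply: tameM_bounded tdu _ _ => // x; exact: sin_norm_le1.
have tuc : tame (fun x => u x * cos (phase x xi)).
  by apply: tameM_bounded tu _ _ => // x; exact: cos_norm_le1.
have dP : deriv_along i (fun x => u x * sin (phase x xi))
    (fun x => du x * sin (phase x xi) + c * (u x * cos (phase x xi))).
  move=> x; have dux := duP x.
  rewrite (_ : line i _ x = fun t => line i u x t * sin (t * c + phase x xi)); last first.
    by apply/funext => t; rewrite /line -phase_line.
  apply: is_derive_eq; rewrite /line scale0r !add0r mul0r add0r /GRing.scale/=; ring.
have := integral_deriv_along tus (tameD tdus (tameZ c tuc)) dP.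
rewrite RintegralD//; [|exact: tame_integrable|exact/tame_integrable/tameZ].
rewrite RintegralZl//; last exact: tame_integrable.
by move=> /eqP; rewrite addr_eq0 mulNr => /eqP.
Qed.

Lemma powerT_deriv xi : powerT du xi = (2 * pi * xi ord0 i) ^+ 2 * powerT u xi.
Proof. by rewrite /powerT cosT_deriv sinT_deriv; ring. Qed.

(** The derivative of x_i u^2, which is u^2 + 2 x_i u du, integrates to zero; x_i u^2 is tame as the
    product of the tame functions x_i u and u. *)
Lemma integral_sqr_byparts :
  \int[mu]_x (u x ^+ 2) = - (2 * \int[mu]_x (x ord0 i * u x * du x)).
Proof.
have dP : deriv_along i (fun x => x ord0 i * u x * u x)
    (fun x => u x * u x + 2 * (x ord0 i * u x * du x)).
  move=> x; have dux := duP x.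
  rewrite (_ : line i _ x = fun t => (t + x ord0 i) * line i u x t * line i u x t); last first.
    by apply/funext => t; rewrite /line !mxE !eqxx mulr1.
  apply: is_derive_eq; rewrite /line scale0r !add0r /GRing.scale/=; ring.
have tuu := tameM tu tu; have txudu := tameM txu tdu.
have := integral_deriv_along (tameM txu tu) (tameD tuu (tameZ 2 txudu)) dP.
rewrite RintegralD//; [|exact: tame_integrable|exact/tame_integrable/tameZ].
rewrite RintegralZl//; last exact: tame_integrable.
by move=> /eqP; rewrite addr_eq0 => /eqP.
Qed.

Lemma integral_sqr_le (l : R) : 0 < l ->
  \int[mu]_x (u x ^+ 2) <=
  l * \int[mu]_x ((x ord0 i * u x) ^+ 2) + l^-1 * \int[mu]_x (du x ^+ 2).
Proof.
move=> l0; rewrite integral_sqr_byparts -mulNr.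
have tp := tameM txu tdu.
have tx2 : tame (fun x => (x ord0 i * u x) ^+ 2) by exact: tameM txu txu.
have td2 : tame (fun x => du x ^+ 2) by exact: tameM tdu tdu.
rewrite -(RintegralZl (- 2) measurableT (tame_integrable tp)).
rewrite -(RintegralZl l measurableT (tame_integrable tx2)).
rewrite -(RintegralZl l^-1 measurableT (tame_integrable td2)).
rewrite -(RintegralD measurableT (tame_integrable (tameZ l tx2))
  (tame_integrable (tameZ l^-1 td2))).
apply: le_Rintegral => //.
- exact: (tame_integrable (tameZ (- 2) tp)).
- exact: (tame_integrable (tameD (tameZ l tx2) (tameZ l^-1 td2))).
move=> x _; set a := x ord0 i * u x; set b := du x.
(* The weighted inequality of the means holds pointwise by completing the square. *)
rewrite -subr_ge0 (_ : _ - _ = l^-1 * (l * a + b) ^+ 2).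
  by rewrite mulr_ge0 ?sqr_ge0// invr_ge0 ltW.
by field; rewrite gt_eqF.
Qed.

End derivative_identities.

(** * Schwartz functions *)

Section schwartz_tame.
Context {R : realType} {d : nat}.
Notation mu := (lebesgue_rV R d).
Implicit Types (x : 'rV[R]_d) (i : 'I_d).

Lemma normc_sqr (z : R[i]) : Normc.normc z ^+ 2 = complex.Re z ^+ 2 + complex.Im z ^+ 2.
Proof. by case: z => a b /=; rewrite sqr_sqrtr// addr_ge0 ?sqr_ge0. Qed.

Lemma normc_ge0 (z : R[i]) : 0 <= Normc.normc z.
Proof. by case: z => a b /=; exact: sqrtr_ge0. Qed.

Lemma Re_le_normc (z : R[i]) : `|complex.Re z| <= Normc.normc z.
Proof.
rewrite -(ler_pXn2r (n := 2))// ?nnegrE ?normr_ge0 ?normc_ge0//.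
by rewrite normc_sqr real_normK ?num_real// lerDl sqr_ge0.
Qed.

Lemma Im_le_normc (z : R[i]) : `|complex.Im z| <= Normc.normc z.
Proof.
rewrite -(ler_pXn2r (n := 2))// ?nnegrE ?normr_ge0 ?normc_ge0//.
by rewrite normc_sqr real_normK ?num_real// lerDr sqr_ge0.
Qed.

(* Expanding [\prod_i (1 + x_i ^ 2)] reduces the decay to finitely many monomial
   bounds. *)
Lemma monomial_decays (h : 'rV[R]_d -> R) :
  (forall a : 'I_d -> nat, exists M : R, forall x,
     `|\prod_(i < d) x ord0 i ^+ a i| * `|h x| <= M) ->
  decays h.
Proof.
move=> hM.
have /choice[M MP] : forall S : {set 'I_d}, exists M : R, forall x,
    `|\prod_(i < d) x ord0 i ^+ (2 * (i \in S))%N| * `|h x| <= M.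
  by move=> S; exact: hM.
exists (\sum_S M S) => x.
rewrite /lorentz /prodf prodfV ler_pdivlMr; last first.
  by apply: prodr_gt0 => i _; exact: (lt_le_trans ltr01 (oneDsqr_ge1 _)).
rewrite /oneDsqr (eq_bigr (fun i => x ord0 i ^+ 2 + 1)); last by move=> i _; rewrite addrC.
rewrite bigA_distr/= mulr_sumr; apply: ler_sum => S _.
rewrite mulrC (le_trans _ (MP S x))// ler_wpM2r//.
rewrite (le_trans (ler_norm _))// (eq_bigr (fun i => x ord0 i ^+ (2 * (i \in S))%N))//.
by move=> i _; case: (i \in S); rewrite ?muln1 ?muln0 ?expr0.
Qed.

(** The hypotheses of the derivative identities, in every coordinate direction at once. *)
Definition nice (u : 'rV[R]_d -> R) := tame u /\
  forall i, [/\ tame (fun x => x ord0 i * u x),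
    tame (fun x => 'D_(delta_mx ord0 i) u x) &
    deriv_along i u (fun x => 'D_(delta_mx ord0 i) u x)].

Let mul_coord_monomial (a : 'I_d -> nat) i x (c : R) :
  `|\prod_(j < d) x ord0 j ^+ a j| * `|x ord0 i * c| =
  `|\prod_(j < d) x ord0 j ^+ (a j + (j == i))%N| * `|c|.
Proof.
rewrite normrM mulrA -normrM; congr (`|_| * _).
rewrite [in RHS](bigD1 i)//= (bigD1 i)//= eqxx addn1 exprSr mulrAC.
congr (_ * _); apply: eq_bigr => j ji.
by rewrite (negbTE ji) addn0.
Qed.

(** Abstracting over [part] treats real and imaginary parts together. Multiplication by a coordinate
    only raises one exponent in the monomial bounds, so [x_i u] decays as well. *)
Let nice_part (part : R[i] -> R) (f : 'rV[R]_d -> R[i]) :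
  (forall z, `|part z| <= Normc.normc z) ->
  (forall i x, part (partial i f x) = 'D_(delta_mx ord0 i) (part \o f) x) ->
  (forall s, continuous (part \o partials s f)) ->
  (forall i x, derivable (part \o f) x (delta_mx ord0 i)) ->
  (forall (a : 'I_d -> nat) (s : seq 'I_d), exists M : R, forall x,
    `|\prod_(i < d) x ord0 i ^+ a i| * Normc.normc (partials s f x) <= M) ->
  nice (part \o f).
Proof.
move=> part_le part_D part_c part_d fM.
have dec s : decays (part \o partials s f).
  apply: monomial_decays => a; have [M MP] := fM a s; exists M => x.
  by rewrite (le_trans _ (MP x))// ler_wpM2l// part_le.
split; first by split; [exact: (part_c [::])|exact: (dec [::])].
move=> i; split; last exact: derivable_deriv_along.
  split.
    move=> x; exact: (cvgM (@coord_continuous _ _ _ ord0 i x) (part_c [::] x)).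
  apply: monomial_decays => a.
  have [M MP] := fM (fun j => a j + (j == i))%N [::]; exists M => x.
  by rewrite mul_coord_monomial (le_trans _ (MP x))// ler_wpM2l// part_le.
rewrite (_ : (fun x => _) = part \o partials [:: i] f).
  by split; [exact: part_c|exact: dec].
by apply/funext => x; rewrite /= part_D.
Qed.

Lemma schwartz_re_nice f : schwartz f -> nice (re_part f).
Proof.
move=> [sf fM]; apply: (@nice_part (@complex.Re R) f) => //.
- exact: Re_le_normc.
- by move=> s; have [] := sf s.
- by move=> i x; have [_ _ /(_ i x)[]] := sf [::].
Qed.

Lemma schwartz_im_nice f : schwartz f -> nice (im_part f).
Proof.
move=> [sf fM]; apply: (@nice_part (@complex.Im R) f) => //.
- exact: Im_le_normc.
- by move=> s; have [] := sf s.
- by move=> i x; have [_ _ /(_ i x)[]] := sf [::].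
Qed.

End schwartz_tame.

(** * The transform of a complex-valued function *)

Section uncertainty.
Context {R : realType} {d : nat}.
Notation mu := (lebesgue_rV R d).
Implicit Types (x xi : 'rV[R]_d) (i : 'I_d) (u : 'rV[R]_d -> R).

Lemma enorm_sqr x : enorm x ^+ 2 = \sum_(i < d) x ord0 i ^+ 2.
Proof. by rewrite sqr_sqrtr// sumr_ge0// => i _; exact: sqr_ge0. Qed.

(** The integral is required to be a real number because [fine] in [L2norm] would send an infinite
    norm to 0. *)
Lemma L2norm_sqr (f : 'rV[R]_d -> R[i]) (N : R) : 0 <= N ->
  (\int[mu]_x (Normc.normc (f x) ^+ 2)%:E = N%:E)%E -> L2norm f ^+ 2 = N.
Proof.
move=> N0 fN; rewrite /L2norm unlock.
under eq_integral => x _ do rewrite /= ger0_norm ?normc_ge0// powR_mulrn ?normc_ge0//.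
by rewrite fN poweR_EFin powR12_sqrt//= sqr_sqrtr.
Qed.

(** For f = u + iv, expand (cosT u - i sinT u) + i (cosT v - i sinT v) into real and imaginary
    parts. *)
Lemma powerT_decomp (f : 'rV[R]_d -> R[i]) xi :
  mu.-integrable setT (EFin \o re_part f) ->
  mu.-integrable setT (EFin \o im_part f) ->
  Normc.normc (fourier f xi) ^+ 2 =
  (cosT (re_part f) xi + sinT (im_part f) xi) ^+ 2 +
  (cosT (im_part f) xi - sinT (re_part f) xi) ^+ 2.
Proof.
move=> ui vi; rewrite normc_sqr /fourier /Cintegral /=.
congr (_ ^+ 2 + _ ^+ 2).
  rewrite /cosT /sinT -RintegralD//; [|exact: integrable_cosT|exact: integrable_sinT].
  apply: eq_Rintegral => x _; rewrite /re_part /im_part /cis /phase.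
  by case: (f x) => a b /=; rewrite cosN sinN; ring.
rewrite /cosT /sinT -RintegralB//; [|exact: integrable_cosT|exact: integrable_sinT].
apply: eq_Rintegral => x _; rewrite /re_part /im_part /cis /phase.
by case: (f x) => a b /=; rewrite cosN sinN; ring.
Qed.

Let phaseN x xi : phase x (- xi) = - phase x xi.
Proof. by rewrite /phase -scaleN1r dotpZr; ring. Qed.

Lemma cosTN u xi : cosT u (- xi) = cosT u xi.
Proof. by apply: eq_Rintegral => x _; rewrite phaseN cosN. Qed.

Lemma sinTN u xi : mu.-integrable setT (EFin \o u) -> sinT u (- xi) = - sinT u xi.
Proof.
move=> ui; rewrite -mulN1r -RintegralZl//; last exact: integrable_sinT.
by apply: eq_Rintegral => x _; rewrite phaseN sinN; ring.
Qed.

(* The reflection of [xi] cancels the cross terms between the transforms of the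
   real and imaginary parts. *)
Lemma integral_fourier_sqr (f : 'rV[R]_d -> R[i]) (g : 'rV[R]_d -> R) :
  mu.-integrable setT (EFin \o re_part f) ->
  mu.-integrable setT (EFin \o im_part f) ->
  measurable_fun setT g -> (forall xi, 0 <= g xi) -> (forall xi, g (- xi) = g xi) ->
  (\int[mu]_xi (g xi * Normc.normc (fourier f xi) ^+ 2)%:E =
   \int[mu]_xi (g xi * powerT (re_part f) xi)%:E +
   \int[mu]_xi (g xi * powerT (im_part f) xi)%:E)%E.
Proof.
move=> ui vi mg g0 gN; set u := re_part f; set v := im_part f.
pose F xi := (g xi * Normc.normc (fourier f xi) ^+ 2)%:E.
have mF : measurable_fun setT F.
  apply/measurable_EFinP; apply: measurable_funM => //.
  under eq_fun do rewrite powerT_decomp//.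
  apply: measurable_funD; apply: measurable_funX.
    by apply: measurable_funD; [exact: measurable_cosT|exact: measurable_sinT].
  by apply: measurable_funB; [exact: measurable_cosT|exact: measurable_sinT].
have F0 xi : (0 <= F xi)%E by rewrite lee_fin mulr_ge0// sqr_ge0.
have n1 : -1 != 0 :> R by rewrite oppr_eq0 oner_eq0.
have FN : (\int[mu]_xi F (- xi)%R = \int[mu]_xi F xi)%E.
  have := ge0_integral_affine 0 n1 mF F0.
  rewrite normrN1 expr1n mul1e => <-; apply: eq_integral => xi _.
  by rewrite scaleN1r addr0.
have mFN : measurable_fun setT (fun xi : 'rV[R]_d => F (- xi)).
  rewrite (_ : (fun xi => F _) = F \o (fun x : 'rV[R]_d => (-1) *: x + 0)%R).
    exact: (measurableT_comp mF (measurable_affine_rV (-1) (0 : 'rV[R]_d))).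
  by apply/funext => xi /=; rewrite scaleN1r addr0.
pose P w xi := (g xi * powerT w xi)%:E.
have P0 w xi : (0 <= P w xi)%E.
  by rewrite lee_fin; apply: mulr_ge0; [exact: g0|exact: powerT_ge0].
have mP w : mu.-integrable setT (EFin \o w) -> measurable_fun setT (P w).
  move=> wi; apply/measurable_EFinP.
  by apply: measurable_funM; [exact: mg|exact: measurable_powerT].
have FF : (\int[mu]_xi F xi + \int[mu]_xi F xi =
    2%:E * (\int[mu]_xi P u xi + \int[mu]_xi P v xi))%E.
  rewrite -[X in (_ + X)%E]FN.
  rewrite -(ge0_integralD mu measurableT (fun x _ => F0 x) mF (fun x _ => F0 (- x)) mFN).
  rewrite -(ge0_integralD mu measurableT (fun x _ => P0 u x) (mP u ui)
    (fun x _ => P0 v x) (mP v vi)).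
  have mPP := emeasurable_funD (mP u ui) (mP v vi).
  have PP0 xi : setT xi -> (0 <= P u xi + P v xi)%E by move=> _; apply: adde_ge0; exact: P0.
  rewrite -(ge0_integralZl mu measurableT mPP PP0); last by rewrite lee_fin.
  apply: eq_integral => xi _; rewrite /F /P -!EFinD -EFinM; congr EFin.
  rewrite !(powerT_decomp _ ui vi) -/u -/v !cosTN !(sinTN _ ui) !(sinTN _ vi) gN /powerT.
  by move: (cosT u xi) (sinT u xi) (cosT v xi) (sinT v xi) (g xi) => a b c k t; ring.
(* The integrals may be infinite, so the factor 2 is removed by multiplying by 1/2, which is valid
   for every extended real. *)
have half (z : \bar R) : ((2^-1)%:E * (2%:E * z) = z)%E.
  by rewrite muleA -EFinM mulVf ?mul1e// pnatr_eq0.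
rewrite -[LHS]half -[RHS]half -FF mule_natl mule2n.
exact: erefl.
Qed.

Lemma integral_powerT_nice u : nice u ->
  (\int[mu]_xi (powerT u xi)%:E = (\int[mu]_x (u x ^+ 2))%:E)%E.
Proof.
move=> [tu _]; have [M uM] := tame_bounded tu.
rewrite (plancherel (tame_integrable tu) tu.1 uM) EFin_Rintegral//.
exact: (tame_integrable (tameM tu tu)).
Qed.

Lemma integral_coord_powerT_nice u i : nice u ->
  (\int[mu]_xi (xi ord0 i ^+ 2 * powerT u xi)%:E =
   ((2 * pi) ^- 2 * \int[mu]_x ('D_(delta_mx ord0 i) u x ^+ 2))%:E)%E.
Proof.
move=> [tu /(_ i)[txu tdu duP]]; have [M duM] := tame_bounded tdu.
have pi2 : (2 * pi) ^+ 2 != 0 :> R by rewrite expf_neq0// mulf_neq0// gt_eqF// pi_gt0.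
rewrite EFinM EFin_Rintegral; last exact: (tame_integrable (tameM tdu tdu)).
rewrite -(plancherel (tame_integrable tdu) tdu.1 duM).
have mP : measurable_fun setT (fun xi => (powerT (fun x => 'D_(delta_mx ord0 i) u x) xi)%:E).
  by apply/measurable_EFinP; apply: measurable_powerT; exact: tame_integrable.
have P0 xi : setT xi -> (0 <= (powerT (fun x => 'D_(delta_mx ord0 i) u x) xi)%:E)%E.
  by move=> _; rewrite lee_fin; exact: powerT_ge0.
rewrite -(ge0_integralZl mu measurableT mP P0); last first.
  by rewrite lee_fin invr_ge0; exact: sqr_ge0.
apply: eq_integral => xi _; rewrite -EFinM (powerT_deriv tu tdu duP); congr EFin.
move: pi2; set c := 2 * pi; move: (powerT u xi) (xi ord0 i) => P t c0.
by field; apply: contra_neq c0 => ->; rewrite expr0n.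
Qed.

End uncertainty.

(** * Mass, second moment and energy of a Schwartz function *)

Section schwartz_norms.
Context {R : realType} {d : nat}.
Notation mu := (lebesgue_rV R d).
Variable f : 'rV[R]_d -> R[i].
Hypothesis sf : schwartz f.

Let u := re_part f.
Let v := im_part f.
Let nu : nice u := schwartz_re_nice sf.
Let nv : nice v := schwartz_im_nice sf.
Let ui := tame_integrable nu.1.
Let vi := tame_integrable nv.1.

Definition mass : R := \int[mu]_x (u x ^+ 2) + \int[mu]_x (v x ^+ 2).

Definition second_moment : R := \sum_(i < d)
  (\int[mu]_x ((x ord0 i * u x) ^+ 2) + \int[mu]_x ((x ord0 i * v x) ^+ 2)).

Definition energy : R := \sum_(i < d)
  (\int[mu]_x ('D_(delta_mx ord0 i) u x ^+ 2) + \int[mu]_x ('D_(delta_mx ord0 i) v x ^+ 2)).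

Let sqr_integrable (h : 'rV[R]_d -> R) : tame h ->
  mu.-integrable setT (fun x => (h x ^+ 2)%:E).
Proof. by move=> th; exact: (tame_integrable (tameM th th)). Qed.

Lemma second_moment_ge0 : 0 <= second_moment.
Proof.
apply: sumr_ge0 => i _.
by rewrite addr_ge0// Rintegral_ge0// => x _; exact: sqr_ge0.
Qed.

Lemma energy_ge0 : 0 <= energy.
Proof.
apply: sumr_ge0 => i _.
by rewrite addr_ge0// Rintegral_ge0// => x _; exact: sqr_ge0.
Qed.

Lemma integral_normc_sqr :
  (\int[mu]_x (Normc.normc (f x) ^+ 2)%:E = mass%:E)%E.
Proof.
rewrite EFinD (EFin_Rintegral (sqr_integrable nu.1)) (EFin_Rintegral (sqr_integrable nv.1)).
rewrite -(integralD measurableT (sqr_integrable nu.1) (sqr_integrable nv.1)).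
by apply: eq_integral => x _; rewrite normc_sqr EFinD.
Qed.

Lemma integral_moment_normc_sqr :
  (\int[mu]_x (enorm x ^+ 2 * Normc.normc (f x) ^+ 2)%:E = second_moment%:E)%E.
Proof.
have xu i := sqr_integrable (let: And3 txu _ _ := nu.2 i in txu).
have xv i := sqr_integrable (let: And3 txv _ _ := nv.2 i in txv).
rewrite /second_moment -sumEFin.
under [RHS]eq_bigr => i _.
  rewrite EFinD (EFin_Rintegral (xu i)) (EFin_Rintegral (xv i)).
  rewrite -(integralD measurableT (xu i) (xv i)).
  over.
rewrite -integral_sum//; last by move=> i; exact: integrableD.
apply: eq_integral => x _; rewrite enorm_sqr normc_sqr mulr_suml -sumEFin.
by apply: eq_bigr => i _; rewrite mulrDr -!exprMn EFinD.
Qed.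

Lemma integral_fourier_normc_sqr :
  (\int[mu]_xi (Normc.normc (fourier f xi) ^+ 2)%:E = mass%:E)%E.
Proof.
have m1 : measurable_fun setT (cst 1 : 'rV[R]_d -> R) by [].
have := integral_fourier_sqr ui vi m1 (fun=> ler01) (fun=> erefl).
under [X in X = _ -> _]eq_integral do rewrite mul1r.
under [X in _ = (X + _)%E -> _]eq_integral do rewrite mul1r.
under [X in _ = (_ + X)%E -> _]eq_integral do rewrite mul1r.
by rewrite (integral_powerT_nice nu) (integral_powerT_nice nv) -EFinD.
Qed.

Lemma integral_moment_fourier_normc_sqr :
  (\int[mu]_xi (enorm xi ^+ 2 * Normc.normc (fourier f xi) ^+ 2)%:E =
   ((2 * pi) ^- 2 * energy)%:E)%E.
Proof.
have mc i : measurable_fun setT (fun xi : 'rV[R]_d => xi ord0 i ^+ 2).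
  by apply: measurable_funX; exact: measurable_coord.
have coord i : (\int[mu]_xi (xi ord0 i ^+ 2 * Normc.normc (fourier f xi) ^+ 2)%:E =
    ((2 * pi) ^- 2 * (\int[mu]_x ('D_(delta_mx ord0 i) u x ^+ 2) +
       \int[mu]_x ('D_(delta_mx ord0 i) v x ^+ 2)))%:E)%E.
  rewrite (integral_fourier_sqr ui vi (mc i)); last 2 first.
  - by move=> xi; exact: sqr_ge0.
  - by move=> xi; rewrite !mxE sqrrN.
  rewrite (integral_coord_powerT_nice i nu) (integral_coord_powerT_nice i nv).
  by rewrite -EFinD -mulrDr.
rewrite /energy mulr_sumr -sumEFin.
under [RHS]eq_bigr => i _ do rewrite -coord.
rewrite -ge0_integral_sum; last 3 first.
- by [].
- move=> i; apply/measurable_EFinP; apply: measurable_funM; first exact: mc.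
  under eq_fun do rewrite (powerT_decomp _ ui vi).
  have mcu := measurable_cosT ui; have mcv := measurable_cosT vi.
  have msu := measurable_sinT ui; have msv := measurable_sinT vi.
  by apply: measurable_funD; apply: measurable_funX;
    [exact: measurable_funD|exact: measurable_funB].
- by move=> i xi _; rewrite lee_fin; apply: mulr_ge0; exact: sqr_ge0.
apply: eq_integral => xi _; rewrite enorm_sqr mulr_suml -sumEFin.
exact: eq_bigr.
Qed.

(** The factor d appears here: each of the d coordinates bounds the full mass by its own terms of
    [second_moment] and [energy], with the same [l] throughout. *)
Lemma dim_mass_le (l : R) : 0 < l ->
  d%:R * mass <= l * second_moment + l^-1 * energy.
Proof.
move=> l0; rewrite /second_moment /energy !mulr_sumr -big_split/=.
rewrite mulr_natl -[d in mass *+ d]card_ord -sumr_const; apply: ler_sum => i _.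
have [txu tdu duP] := nu.2 i; have [txv tdv dvP] := nv.2 i.
rewrite /mass !mulrDr [leRHS]addrACA.
exact: lerD (integral_sqr_le nu.1 tdu txu duP l0) (integral_sqr_le nv.1 tdv txv dvP l0).
Qed.

(** A nonzero f has a real or imaginary part that is nonzero somewhere, and that part is continuous.
    Positive mass makes the final quotients meaningful. *)
Lemma mass_gt0 : f <> (fun=> 0) -> 0 < mass.
Proof.
move=> f0.
have sqr_gt0 h : tame h -> (exists x, h x != 0) -> 0 < \int[mu]_x (h x ^+ 2).
  move=> th hx; rewrite -lte_fin (EFin_Rintegral (sqr_integrable th)).
  exact: integral_sqr_gt0 th.1 hx.
have sqr_ge0' (h : 'rV[R]_d -> R) : 0 <= \int[mu]_x (h x ^+ 2).
  by apply: Rintegral_ge0 => x _; exact: sqr_ge0.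
have [ux|/forallNP u0] := pselect (exists x, u x != 0).
  by rewrite ltr_pwDl// sqr_gt0//; exact: nu.1.
have [vx|/forallNP v0] := pselect (exists x, v x != 0).
  by rewrite ltr_wpDl// sqr_gt0//; exact: nv.1.
exfalso; apply: f0; apply/funext => x.
have /negP/negPn/eqP := u0 x; have /negP/negPn/eqP := v0 x.
by rewrite /u /v /re_part /im_part; case: (f x) => a b /= -> ->.
Qed.

End schwartz_norms.

Lemma sqr_le_of_AMGM (R : realFieldType) (c A B : R) : 0 <= c -> 0 <= A -> 0 <= B ->
  (forall l, 0 < l -> c <= l * A + l^-1 * B) -> c ^+ 2 <= 4 * (A * B).
Proof.
move=> c0 A0 B0 h; have [->|cn0] := eqVneq c 0.
  by rewrite expr0n/= !mulr_ge0.
have cp : 0 < c by rewrite lt_neqAle eq_sym cn0.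
move: A0; rewrite le_eqVlt => /predU1P[A0|Ap].
  (* When A = 0 a large [l] is contradictory: this choice would give 2 B + 1 <= B. *)
  have lp : 0 < (2 * B + 1) / c by rewrite divr_gt0// ltr_wpDl// mulr_ge0.
  have := h _ lp; rewrite -A0 mulr0 add0r invf_div mulrAC ler_pdivlMr; last by lra.
  by rewrite ler_pM2l// => ?; lra.
(* This [l] makes the first term c / 2, so no square root is needed and B = 0 is not a special
   case. *)
have lp : 0 < c / (2 * A) by rewrite divr_gt0// mulr_gt0.
have := h _ lp; rewrite invf_div.
rewrite (_ : c / (2 * A) * A = c / 2); last by field; rewrite gt_eqF.
rewrite (_ : 2 * A / c * B = 2 * (A * B) / c); last by field; rewrite gt_eqF.
rewrite -lerBlDl ler_pdivlMr// => ?; rewrite expr2; lra.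
Qed.

Theorem theorem1 (R : realType) :
  let uncertainty (C : R) :=
    forall (d : nat) (f : 'rV[R]_d -> R[i]),
      (1 <= d)%N -> schwartz f -> f <> (fun _ => 0) ->
      moment2 f / L2norm f ^+ 2 *
        (moment2 (fourier f) / L2norm (fourier f) ^+ 2)
      >= C * d%:R ^+ 2 in
  (exists C : R, 0 < C /\ uncertainty C) /\ uncertainty (1 / 10 ^+ 10).
Proof.
move=> uncertainty; suff main : uncertainty (1 / 10 ^+ 10).
  by split=> //; exists (1 / 10 ^+ 10); split=> //; rewrite divr_gt0// exprn_gt0.
move=> d f _ sf f0.
have N0 := mass_gt0 sf f0; set N := mass f in N0.
rewrite (L2norm_sqr (ltW N0) (integral_normc_sqr sf)).
rewrite (L2norm_sqr (ltW N0) (integral_fourier_normc_sqr sf)).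
rewrite /moment2 /Rintegral (integral_moment_normc_sqr sf).
rewrite (integral_moment_fourier_normc_sqr sf)/=.
have := sqr_le_of_AMGM _ (second_moment_ge0 f) (energy_ge0 f) (dim_mass_le sf).
move=> /(_ (mulr_ge0 (ler0n _ _) (ltW N0))); rewrite -/N.
move: (second_moment f) (energy f) => A B dN.
(* The sharp constant 1 / (16 pi^2) is at least 1/256 because pi <= 4, so any denominator from 256
   on works. The split 3 + 7 keeps the comparison of natural numbers small. *)
have T256 : 256 <= 10 ^+ 10 :> R.
  rewrite (_ : 10%N = (3 + 7)%N)// exprD -[leLHS]mulr1 ler_pM ?ler01//; last first.
    by rewrite exprn_ege1// ler1n.
  by rewrite -natrX ler_nat.
move: (10 ^+ 10 : R) T256 => T T256.
have T0 : 0 < T by lra.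
have pi4 : (pi : R) <= 4 by have := @pihalf_lt2 R; lra.
have pi0 := @pi_gt0 R.
move: (pi : R) pi4 pi0 => p p4 p0.
rewrite (_ : _ / N * _ = (A * B) / (4 * p ^+ 2 * N ^+ 2)); last first.
  have Nn0 : N != 0 by exact: lt0r_neq0.
  have pn0 : p != 0 by exact: lt0r_neq0.
  by field; rewrite Nn0 pn0.
rewrite ler_pdivlMr; last by rewrite !mulr_gt0// exprn_gt0.
have p16 : p ^+ 2 <= 16.
  rewrite (_ : 16 = 4 ^+ 2); last by ring.
  by rewrite ler_sqr ?nnegrE// ltW.
rewrite (_ : _ * (4 * _ * _) = (4 / T) * p ^+ 2 * (d%:R * N) ^+ 2); last by field; rewrite gt_eqF.
have dN0 : 0 <= (d%:R * N) ^+ 2 by exact: sqr_ge0.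
(* The bound [dN] says that a quarter of (d N)^2 is at most A B; what remains is 4 p^2 / T <= 1/4,
   which follows from p^2 <= 16 and T >= 256. *)
apply: (@le_trans _ _ (1 / 4 * (d%:R * N) ^+ 2)); last by lra.
rewrite ler_wpM2r//.
have tb : 4 / T <= 1 / 64.
  by rewrite ler_pdivrMr//; lra.
apply: (@le_trans _ _ (1 / 64 * 16)); last by lra.
by apply: ler_pM => //; [rewrite divr_ge0// ltW|exact: sqr_ge0].
Qed.
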